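(* Let $A,K>0$ and $0<\theta<1$. For every $j\ge1$ select $n_j$ randomly and uniformly from the interval $\bigl(j/A-Kj^\theta,\ j/A+Kj^\theta\bigr]\cap\mathbb{R}_{>0}$, independently for different $j$. Then the counting function of $\mathcal{N}=(n_j)_{j\ge1}$ satisfies $N(x)=Ax+O(x^\theta)$, and with probability $1$ there is a constant $C$ such that for all $x\ge1$ and all $t\in\mathbb{R}$, $$\Bigl|\sum_{n_j\le x}n_j^{-\mathrm{i} t}-A\frac{x^{1-\mathrm{i} t}}{1-\mathrm{i} t}\Bigr|\le C\Bigl(\sqrt{x}\bigl(\sqrt{\log(x+1)}+\sqrt{\log(|t|+1)}\bigr)+x^\theta+x^{1-\theta}\Bigr).$$ In particular, when $\theta=1/2$, $\mathrm{LH}(\mathcal{N},Ax)$ holds with probability $1$.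
   Context: $N(x)=\#\{j:n_j\le x\}$ (the sequence need not be monotone). $\mathrm{LH}(\mathcal{N},M(x))$ for differentiable $M$ means: for every $\varepsilon>0$ and $B>0$ there is $C'=C'(\varepsilon,B)$ with $\bigl|\sum_{n_j\le x}n_j^{-\mathrm{i} t}-\int_{n_1}^x u^{-\mathrm{i} t}M'(u)\,\mathrm{d}u\bigr|\le C' M(x)^{1/2}|t|^{\varepsilon}$ for all real $t$ and $n_1\le x\le|t|^B$. *)

(* Defs.v *)
From HB Require Import structures.
From mathcomp Require Import all_boot all_order all_algebra.
From mathcomp Require Import finmap.
From mathcomp Require Import all_classical all_reals all_analysis.
From mathcomp Require Export complex.

Set Implicit Arguments.
Unset Strict Implicit.
Unset Printing Implicit Defensive.

Import Order.TTheory GRing.Theory Num.Theory.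
Import numFieldNormedType.Exports.

Local Open Scope classical_set_scope.
Local Open Scope ring_scope.
Local Open Scope complex_scope.

(* x ^ s = exp (s * ln x) with the real logarithm; meaningful for 0 < x. *)
Definition cpowR (R : realType) (x : R) (s : R[i]) : R[i] :=
  (expR (complex.Re s * ln x))%:C *
  (cos (complex.Im s * ln x) +i* sin (complex.Im s * ln x)).

(* Lebesgue integral over [a, b], so meaningful for a <= b. *)
Definition Cintegral (R : realType) (a b : R) (f : R -> R[i]) : R[i] :=
  Rintegral (@lebesgue_measure R) `[a, b] (fun u => complex.Re (f u)) +i*
  Rintegral (@lebesgue_measure R) `[a, b] (fun u => complex.Im (f u)).

Section Sequences.
Context {R : realType}.
Implicit Types (s : nat -> R) (x t : R).

(* A sequence (n_j), j >= 1, is a function s on nat whose value at 0 is never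
   used. *)
Definition indices_le s x : set nat := [set j | (0 < j)%N /\ s j <= x].

(* [counting_fun] and [power_sum] are junk when [indices_le s x] is infinite. *)
Definition counting_fun s x : nat := #|` fset_set (indices_le s x)|.

Definition power_sum s x t : R[i] :=
  \sum_(j \in indices_le s x) cpowR (s j) (0 -i* t).

Definition LH s (M : R -> R) : Prop :=
  forall eps B : R, 0 < eps -> 0 < B -> exists C : R,
    forall t x, s 1%N <= x -> x <= `|t| `^ B ->
      Normc.normc (power_sum s x t
        - Cintegral (s 1%N) x
            (fun u => cpowR u (0 -i* t) * (derive1 M u)%:C))
      <= C * Num.sqrt (M x) * `|t| `^ eps.

End Sequences.

Section Selection.
Context {R : realType}.
Variables (A K theta : R) (j : nat).

Definition sel_lo : R := Num.max 0 (j%:R / A - K * j%:R `^ theta).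
Definition sel_hi : R := j%:R / A + K * j%:R `^ theta.

Lemma sel_itvE :
  `]j%:R / A - K * j%:R `^ theta, j%:R / A + K * j%:R `^ theta]%classic
    `&` [set y : R | 0 < y] = `]sel_lo, sel_hi]%classic :> set R.
Proof.
apply/seteqP; split=> y /=; rewrite !in_itv /= gt_max.
  by move=> [/andP[-> ->] ->].
by move=> /andP[/andP[-> ->] ->].
Qed.

Lemma sel_lt : 0 < A -> 0 < K -> (0 < j)%N -> sel_lo < sel_hi.
Proof.
move=> A0 K0 j0; have J0 : (0 : R) < j%:R by rewrite ltr0n.
have a0 : 0 < j%:R / A by rewrite divr_gt0.
have b0 : 0 < K * j%:R `^ theta by rewrite mulr_gt0// powR_gt0.
rewrite /sel_lo /sel_hi gt_max addr_gt0//=.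
by rewrite ltrD2l gtrN.
Qed.

End Selection.

Section RandomVariables.
Context {R : realType} {d : measure_display} {T : measurableType d}.
Variable P : probability T R.

(* The library's uniform law lives on [a, b]; the first clause confines the
   values themselves to the half-open interval. *)
Definition uniformly_selected (X : {RV P >-> R}) (a b : R) (ab : a < b) : Prop :=
  (forall w : T, `]a, b]%classic (X w)) /\
  (forall B : set R, measurable B -> distribution P X B = uniform_prob ab B).

Definition mutually_independent (I : choiceType) (J : set I)
    (X : I -> {RV P >-> R}) : Prop :=
  forall (F : {fset I}) (B : I -> set R), [set` F] `<=` J ->
    (forall i, i \in F -> measurable (B i)) ->
    P (\bigcap_(i in [set` F]) (X i @^-1` B i)) =
    (\prod_(i <- F) P (X i @^-1` B i))%E.

End RandomVariables.

(* Main.v *)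
(* Write u ^ (- i t) through its real and imaginary parts, that is through
   cos (t ln u + phi) with phi = 0 and phi = pi / 2.  Every n_j lies within
   O(j ^ theta) of j / A, so that {j | n_j <= x} differs from [1, A x] by
   O(x ^ theta) indices; this gives the counting function and allows one to sum
   over j <= A x instead.

   The mean of the j-th term is the secant slope F(j) of the antiderivative of
   the oscillating function over the j-th window.  Its derivative satisfies
   F' = O(y ^ (- theta)), uniformly in t, and A times the secant slope of the
   second antiderivative has derivative F + O(y ^ (theta - 1)).  Telescoping
   gives A x ^ (1 - i t) / (1 - i t) + O(x ^ theta + x ^ (1 - theta)) for the
   sum of the F(j).

   The centred terms are independent and bounded, so that a Chernoff bound based
   on exp y <= y + exp (2 y ^ 2) makes their sum over j <= N sub-Gaussian.
   Taking t on a grid of mesh 1 / N, the deviation 8 sqrt (N (ln (N + 1) +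
   ln (m + 1))) at t = m / N has probability O(N ^ (-2) m ^ (-2)), which is
   summable, and the Borel-Cantelli lemma applies; the sum is Lipschitz in t
   with constant O(N ln N), hence the bound extends to all t. *)

Require Import Defs.
From HB Require Import structures.
From mathcomp Require Import all_boot all_order all_algebra.
From mathcomp Require Import finmap.
From mathcomp Require Import all_classical all_reals all_analysis.
From mathcomp Require Import measurable_realfun ring lra.

Set Implicit Arguments.
Unset Strict Implicit.
Unset Printing Implicit Defensive.

Import Order.TTheory GRing.Theory Num.Theory.
Import numFieldNormedType.Exports.

Local Open Scope classical_set_scope.
Local Open Scope ring_scope.
Local Open Scope complex_scope.

(** * The oscillating function and its antiderivatives *)

Section RealFunctions.
Context {R : realType}.
Implicit Types (f df : R -> R) (a b t phi u : R).

Lemma mean_value f df a b : a <= b ->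
  (forall x, a <= x <= b -> is_derive x 1 f (df x)) ->
  exists2 c, a <= c <= b & f b - f a = df c * (b - a).
Proof.
move=> ab fd; have [||c] := @MVT_segment R f df a b ab.
- by move=> x; rewrite in_itv/= => /andP[ax xb]; apply: fd; rewrite !ltW.
- apply: derivable_within_continuous => x; rewrite in_itv/= => xab.
  exact: (@ex_derive _ _ _ _ _ _ _ (fd x xab)).
- by rewrite in_itv/= => cab E; exists c.
Qed.

Lemma mean_value_le f df a b M : a <= b ->
  (forall x, a <= x <= b -> is_derive x 1 f (df x)) ->
  (forall x, a <= x <= b -> `|df x| <= M) -> `|f b - f a| <= M * (b - a).
Proof.
move=> ab fd fM; have [c cab ->] := mean_value ab fd.
by rewrite normrM (ger0_norm (x := b - a)) ?subr_ge0// ler_wpM2r ?subr_ge0// fM.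
Qed.

Lemma dist_cos_le a b : `|cos a - cos b| <= `|a - b|.
Proof.
wlog ab : a b / a <= b.
  move=> H; have [|/ltW] := leP a b; first exact: H.
  by move/H; rewrite distrC (distrC b).
rewrite distrC (distrC a) (ger0_norm (x := b - a)) ?subr_ge0// -[leRHS]mul1r.
apply: (mean_value_le (df := fun x => - sin x)) => // x _.
by rewrite normrN sin_max.
Qed.

(* [osc t 0 u] and [osc t (pi / 2) u] are the real and imaginary parts of
   u ^ (- i t). *)
Definition osc t phi u : R := cos (t * ln u + phi).

(* [osc1] and [osc2] are the first two antiderivatives of [osc], that is
   Re (e ^ (- i phi) u ^ (1 - i t) / (1 - i t)) and
   Re (e ^ (- i phi) u ^ (2 - i t) / ((1 - i t) (2 - i t))). *)
Definition osc1 t phi u : R :=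
  u * (cos (t * ln u + phi) + t * sin (t * ln u + phi)) / (1 + t ^+ 2).

Definition osc2 t phi u : R :=
  u ^+ 2 * ((2 - t ^+ 2) * cos (t * ln u + phi) + 3 * t * sin (t * ln u + phi))
  / ((1 + t ^+ 2) * (4 + t ^+ 2)).

Lemma norm_osc_le t phi u : `|osc t phi u| <= 1.
Proof. exact: cos_max. Qed.

Lemma is_derive_cos_ln t phi u : 0 < u ->
  is_derive u 1 (fun v => cos (t * ln v + phi)) (- sin (t * ln u + phi) * (t / u)).
Proof.
move=> u0; have lnd := is_derive1_ln u0.
have d : is_derive u (1 : R^o) (fun v : R => t * ln v + phi) (t / u).
  by apply: is_derive_eq; rewrite addr0 /GRing.scale/= ?mulr0 ?addr0.
have := @is_derive1_comp _ (@cos R) (fun v : R => t * ln v + phi) u _ _ _ d.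
by apply; exact: is_derive_cos.
Qed.

Lemma is_derive_sin_ln t phi u : 0 < u ->
  is_derive u 1 (fun v => sin (t * ln v + phi)) (cos (t * ln u + phi) * (t / u)).
Proof.
move=> u0; have lnd := is_derive1_ln u0.
have d : is_derive u (1 : R^o) (fun v : R => t * ln v + phi) (t / u).
  by apply: is_derive_eq; rewrite addr0 /GRing.scale/= ?mulr0 ?addr0.
have := @is_derive1_comp _ (@sin R) (fun v : R => t * ln v + phi) u _ _ _ d.
by apply; exact: is_derive_sin.
Qed.

Let sqr1_neq0 t : 1 + t ^+ 2 != 0.
Proof. by rewrite gt_eqF// ltr_pwDl// sqr_ge0. Qed.

Let sqr4_neq0 t : 4 + t ^+ 2 != 0.
Proof. by rewrite gt_eqF// ltr_pwDl// sqr_ge0. Qed.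

Lemma is_derive_osc1 t phi u : 0 < u -> is_derive u 1 (osc1 t phi) (osc t phi u).
Proof.
move=> u0; have dc := is_derive_cos_ln t phi u0.
have ds := is_derive_sin_ln t phi u0.
rewrite /osc1 /osc; apply: is_derive_eq; rewrite /GRing.scale/=.
field; apply/andP; split; [by rewrite gt_eqF|exact: sqr1_neq0].
Qed.

Lemma is_derive_osc2 t phi u : 0 < u -> is_derive u 1 (osc2 t phi) (osc1 t phi u).
Proof.
move=> u0; have dc := is_derive_cos_ln t phi u0.
have ds := is_derive_sin_ln t phi u0.
rewrite /osc1 /osc2; apply: is_derive_eq; rewrite /GRing.scale/=.
field; apply/and3P; split; [exact: sqr1_neq0|by rewrite gt_eqF|exact: sqr4_neq0].
Qed.

Lemma norm_osc1_le t phi u : 0 <= u -> `|osc1 t phi u| <= u.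
Proof.
move=> u0; rewrite /osc1 -mulrA normrM (ger0_norm u0) ler_piMr//.
have t1 : 0 < 1 + t ^+ 2 by rewrite ltr_pwDl// sqr_ge0.
rewrite normrM normfV (gtr0_norm t1) ler_pdivrMr// mul1r.
have := cos2Dsin2 (t * ln u + phi).
set c := cos _; set s := sin _ => cs.
(* Cauchy-Schwarz: (c + t s)^2 + (t c - s)^2 = (1 + t^2) (c^2 + s^2). *)
have : (c + t * s) ^+ 2 <= 1 + t ^+ 2.
  by have := sqr_ge0 (t * c - s); nra.
by move=> h; rewrite ler_norml; apply/andP; split; nra.
Qed.

End RealFunctions.

(** * Sums of fractional powers of integers *)

Section PowerSums.
Context {R : realType}.
Implicit Types a y : R.

Lemma powRN_le a y z : 0 <= a -> 0 < y -> y <= z -> z `^ (- a) <= y `^ (- a).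
Proof.
move=> a0 y0 yz; have z0 : 0 < z by exact: lt_le_trans yz.
rewrite !powRN lef_pV2 ?posrE ?powR_gt0//.
by apply: ge0_ler_powR; rewrite // nnegrE ltW.
Qed.

(** Mean value theorem on [j - 1, j], where the derivative of y ^ a is decreasing; [1 < j] keeps the
    interval away from 0. *)
Lemma powR_nat_step_ge a (j : nat) : 0 < a -> a < 1 -> (1 < j)%N ->
  a * j%:R `^ (a - 1) <= j%:R `^ a - j.-1%:R `^ a.
Proof.
move=> a0 a1 j1.
have [|x|c /andP[cl cr] ->] := @mean_value R (fun y => y `^ a)
    (fun y => a * y `^ (a - 1)) j.-1%:R j%:R.
- by rewrite ler_nat leq_pred.
- move=> /andP[xl _]; apply: is_derive1_powR; apply: lt_le_trans xl.
  by rewrite ltr0n -ltnS prednK// (ltn_trans _ j1).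
have c0 : 0 < c.
  by apply: lt_le_trans cl; rewrite ltr0n -ltnS prednK// (ltn_trans _ j1).
have -> : j%:R - j.-1%:R = 1 :> R.
  by rewrite -natrB ?leq_pred// -subn1 subKn// ltnW.
by rewrite mulr1 ler_pM2l// -[a - 1]opprB powRN_le// subr_ge0 ltW.
Qed.

(** Each term is dominated by a difference of powers, and these telescope. It is applied with a =
    theta and a = 1 - theta. *)
Lemma sum_powR_le a (m n : nat) : 0 < a -> a < 1 -> (1 < m)%N ->
  \sum_(m <= j < n) j%:R `^ (a - 1) <= n%:R `^ a / a.
Proof.
move=> a0 a1 m1; have [nm|mn] := leqP n m.
  by rewrite big_geq// divr_ge0 ?powR_ge0// ltW.
rewrite ler_pdivlMr// mulrC mulr_sumr.
apply: (@le_trans _ _ (\sum_(m <= j < n) (j%:R `^ a - j.-1%:R `^ a))).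
  by apply: ler_sum_nat => j /andP[mj _]; apply: powR_nat_step_ge => //;
    apply: leq_trans mj.
have -> : \sum_(m <= j < n) (j%:R `^ a - j.-1%:R `^ a : R) =
    n.-1%:R `^ a - m.-1%:R `^ a.
  rewrite -(prednK (ltnW m1)) -(prednK (ltnW (leq_trans m1 (ltnW mn)))).
  rewrite big_add1 /= (@telescope_sumr _ _ _ (fun j => j%:R `^ a))//.
  by move: mn m1; clear; case: m n => [|m] [|n] //= /ltnW.
apply: (@le_trans _ _ (n.-1%:R `^ a)); first by rewrite gerBl powR_ge0.
by apply: ge0_ler_powR; rewrite ?nnegrE ?ler0n ?ler_nat ?leq_pred ?ltW.
Qed.

End PowerSums.

(** * Secant slopes over the windows and their sum *)

Section MeanValues.
Context {R : realType}.
Variables A K theta : R.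
Hypotheses (A0 : 0 < A) (K0 : 0 < K) (theta0 : 0 < theta) (theta1 : theta < 1).
Implicit Types (H h : R -> R) (y t phi : R).

(** A function of a real variable, so that it can be differentiated, and without the truncation at 0
    of [sel_lo], which has no effect from [j0] on. *)
Definition lo y := y / A - K * y `^ theta.
Definition hi y := y / A + K * y `^ theta.
(** The denominator is the length of the window, so that for H' = h this is the mean of h under the
    uniform law on it. *)
Definition secant H y := (H (hi y) - H (lo y)) / (2 * K * y `^ theta).

(** The first bound amounts to y ^ (1 - theta) >= 2 A K, whence the choice of [z]. From [j0] on the
    half-width of the window is at most half of its centre, and the window lies in [1, +oo). *)
Lemma powR_theta_small : exists2 j0 : nat, (1 < j0)%N &
  forall y, j0%:R <= y -> K * y `^ theta <= y / (2 * A) /\ 2 * A <= y.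
Proof.
have t1 : 0 < 1 - theta by rewrite subr_gt0.
pose z := Num.max ((2 * A * K) `^ (1 - theta)^-1) (2 * A).
exists (Num.truncn z).+2 => // y zy.
have {}zy : z <= y.
  apply/(le_trans _ zy)/ltW; apply: (lt_le_trans (truncnS_gt _)).
  by rewrite ler_nat.
move: zy; rewrite ge_max => /andP[zy Ay]; split=> //.
have y0 : 0 < y by apply: lt_le_trans Ay; rewrite mulr_gt0.
have : 2 * A * K <= y `^ (1 - theta).
  have -> : 2 * A * K = ((2 * A * K) `^ (1 - theta)^-1) `^ (1 - theta).
    by rewrite -powRrM mulVf ?gt_eqF// powRr1// !mulr_ge0 ?ltW.
  by apply: ge0_ler_powR; rewrite ?nnegrE ?powR_ge0//; exact: ltW.
have yE : y = y `^ theta * y `^ (1 - theta).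
  rewrite -powRD ?(gt_eqF y0) ?implybT//.
  by rewrite addrC subrK powRr1 ?ltW.
rewrite ler_pdivlMr ?mulr_gt0// => h; rewrite [leRHS]yE.
have := powR_gt0 theta y0; nra.
Qed.

Let hi' y := A^-1 + K * (theta * y `^ (theta - 1)).
Let lo' y := A^-1 - K * (theta * y `^ (theta - 1)).

(** Product rule; the last term comes from the factor y ^ (- theta). *)
Lemma is_derive_secant H h y : 0 < y -> 0 < lo y ->
  (forall u : R, 0 < u -> is_derive u 1 H (h u)) ->
  is_derive y 1 (secant H)
    ((h (hi y) * hi' y - h (lo y) * lo' y) / (2 * K * y `^ theta)
     - theta / y * secant H y).
Proof.
move=> y0 l0 dH.
have w0 : 0 < y `^ theta by exact: powR_gt0.
have h0 : 0 < hi y.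
  by apply: lt_le_trans l0 _; rewrite /lo /hi; have := mulr_gt0 K0 w0; lra.
have dp := is_derive1_powR theta y0.
have dhi : is_derive y (1 : R^o) hi (hi' y).
  by rewrite /hi; apply: is_derive_eq; rewrite /GRing.scale/= /hi'; ring.
have dlo : is_derive y (1 : R^o) lo (lo' y).
  by rewrite /lo; apply: is_derive_eq; rewrite /GRing.scale/= /lo'; ring.
have dHhi := @is_derive1_comp _ H hi y _ _ (dH _ h0) dhi.
have dHlo := @is_derive1_comp _ H lo y _ _ (dH _ l0) dlo.
pose V (z : R) := (2 * K * z `^ theta)^-1.
have dV : is_derive y 1 V (- (theta / y) * V y).
  have d2 : is_derive y (1 : R^o) (fun z => 2 * K * z `^ theta)
      (2 * K * (theta * y `^ (theta - 1))).
    by apply: is_derive_eq; rewrite /GRing.scale/=; ring.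
  have n0 : 2 * K * y `^ theta != 0 by rewrite !mulf_neq0// gt_eqF.
  apply: (is_derive_eq (@is_deriveV _ (fun z => 2 * K * z `^ theta) _ _ _ n0 d2)).
  rewrite /V /GRing.scale/= -(mulr_powRB1 (ltW y0) theta0).
  have q0 : 0 < y `^ (theta - 1) by rewrite powR_gt0.
  by field; rewrite !gt_eqF.
have -> : secant H = fun z => (H (hi z) - H (lo z)) * V z by [].
apply: is_derive_eq; rewrite /GRing.scale/= /V.
by field; rewrite !gt_eqF.
Qed.

(** By the mean value theorem; any bound for h on the window thus passes to the secant slope. *)
Lemma secant_mean H h y : 0 < y -> 0 < lo y ->
  (forall u : R, 0 < u -> is_derive u 1 H (h u)) ->
  exists2 c, lo y <= c <= hi y & secant H y = h c.
Proof.
move=> y0 l0 dH; have w0 : 0 < K * y `^ theta by rewrite mulr_gt0// powR_gt0.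
have [|x /andP[xl _]|c cy E] := @mean_value R H h (lo y) (hi y).
- by rewrite /lo /hi; lra.
- by apply: dH; apply: lt_le_trans xl.
exists c => //; rewrite /secant E.
have -> : hi y - lo y = 2 * K * y `^ theta by rewrite /hi /lo; ring.
by rewrite mulfK// -mulrA mulf_neq0// gt_eqF.
Qed.

Variable j0 : nat.
Hypothesis j01 : (1 < j0)%N.
Hypothesis j0P : forall y : R, j0%:R <= y -> K * y `^ theta <= y / (2 * A) /\ 2 * A <= y.

Lemma ge1_large y : j0%:R <= y -> 1 <= y.
Proof. by apply: le_trans; rewrite ler1n ltnW. Qed.

Lemma lo_ge1 y : j0%:R <= y -> 1 <= lo y.
Proof.
move=> /j0P[yk Ay]; rewrite /lo.
have : 1 <= y / (2 * A) by rewrite ler_pdivlMr ?mulr_gt0// mul1r.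
have -> : y / A = 2 * (y / (2 * A)) by field; rewrite gt_eqF.
by lra.
Qed.

Lemma norm_secant_osc1_le t phi y : j0%:R <= y -> `|secant (osc1 t phi) y| <= 1.
Proof.
move=> yj; have y1 := ge1_large yj; have l1 := lo_ge1 yj.
have [||c _ ->] := @secant_mean _ (osc t phi) y _ _ (@is_derive_osc1 _ t phi).
- exact: lt_le_trans y1.
- exact: lt_le_trans l1.
- exact: norm_osc_le.
Qed.

(** The derivative of the secant slope involves only values of [osc] and their mean, all bounded by
    1, and never the derivative of [osc]; hence the uniformity in t. *)
Lemma dist_secant_osc1_le t phi y z : j0%:R <= y -> y <= z -> z <= y + 1 ->
  `|secant (osc1 t phi) z - secant (osc1 t phi) y|
  <= ((A * K)^-1 + 2) * y `^ (- theta).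
Proof.
move=> yj yz zy.
apply: (@le_trans _ _ (((A * K)^-1 + 2) * y `^ (- theta) * (z - y))); last first.
  rewrite ler_piMr//; last by lra.
  by rewrite mulr_ge0 ?powR_ge0// addr_ge0// invr_ge0 mulr_ge0 ?ltW.
apply: (@mean_value_le _ _ (fun y => (osc t phi (hi y) * hi' y -
  osc t phi (lo y) * lo' y) / (2 * K * y `^ theta)
     - theta / y * secant (osc1 t phi) y)) => // x /andP[yx _].
  have xj := le_trans yj yx.
  apply: is_derive_secant; last exact: is_derive_osc1.
  - exact: lt_le_trans (ge1_large xj).
  - exact: lt_le_trans (lo_ge1 xj).
have xj := le_trans yj yx; have x1 := ge1_large xj.
have x0 : 0 < x by exact: lt_le_trans x1.
have y0 : 0 < y by apply: lt_le_trans (ge1_large yj).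
apply: (@le_trans _ _ (((A * K)^-1 + 2) * x `^ (- theta))); last first.
  rewrite ler_wpM2l ?powRN_le ?(ltW theta0)//.
  by rewrite addr_ge0// invr_ge0 mulr_ge0 ?ltW.
have S1 := norm_secant_osc1_le t phi xj.
have O1 := norm_osc_le t phi (hi x); have O2 := norm_osc_le t phi (lo x).
set S := secant _ _ in S1 *; set o1 := osc _ _ _ in O1 *.
set o2 := osc _ _ _ in O2 *.
have p0 : 0 < x `^ theta by exact: powR_gt0.
have q1 : x `^ (theta - 1) = x `^ theta / x.
  by rewrite powRB ?(gt_eqF x0) ?implybT// powRr1// ltW.
rewrite powRN /hi' /lo' q1.
have px : x^-1 <= (x `^ theta)^-1.
  by rewrite lef_pV2 ?posrE// ler1_powR// ltW.
set p := x `^ theta in p0 px *.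
(* The first summand comes from the motion of the centre of the window, the second from the change
   of its width. The latter is O(1 / x), hence O(x ^ (- theta)) as x >= 1. *)
have -> : (o1 * (A^-1 + K * (theta * (p / x))) -
    o2 * (A^-1 - K * (theta * (p / x)))) / (2 * K * p) - theta / x * S =
   (o1 - o2) * (2 * (A * K))^-1 * p^-1 + theta * x^-1 * ((o1 + o2) / 2 - S).
  by field; rewrite !gt_eqF.
apply: (le_trans (ler_normD _ _)); rewrite [leRHS]mulrDl lerD//.
  rewrite normrM normfV (gtr0_norm p0) ler_wpM2r ?invr_ge0 ?(ltW p0)//.
  have AK0 : 0 < (A * K)^-1 by rewrite invr_gt0 mulr_gt0.
  rewrite normrM invfM normrM (gtr0_norm AK0) mulrA ler_piMl ?(ltW AK0)//.
  rewrite (gtr0_norm (x := 2^-1)) ?invr_gt0//.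
  by rewrite ler_pdivrMr// mul1r (le_trans (ler_normB _ _))//; lra.
rewrite normrM mulrC ler_pM//.
  move: S1 O1 O2; rewrite !ler_norml => /andP[? ?] /andP[? ?] /andP[? ?].
  by apply/andP; split; lra.
rewrite ger0_norm; last by rewrite mulr_ge0 ?invr_ge0 ?ltW.
by apply: (le_trans _ px); rewrite ler_piMl ?(ltW theta1)// invr_ge0 ltW.
Qed.

(** The motion of the centre contributes exactly [secant (osc1 t phi) x]. What remains is A theta /
    x times the difference between the average of [osc1] at the two ends and its value at an inner
    point [c]; as [osc1] is 1-Lipschitz, this difference is at most the length of the window. *)
Lemma dist_derive_secant_osc2_le t phi x : j0%:R <= x ->
  `|A * ((osc1 t phi (hi x) * hi' x - osc1 t phi (lo x) * lo' x)
      / (2 * K * x `^ theta) - theta / x * secant (osc2 t phi) x)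
    - secant (osc1 t phi) x| <= 2 * A * K * x `^ (theta - 1).
Proof.
move=> xj; have x1 := ge1_large xj; have l1 := lo_ge1 xj.
have x0 : 0 < x by exact: lt_le_trans x1.
have l0 : 0 < lo x by exact: lt_le_trans l1.
have [c /andP[lc ch] ->] := secant_mean x0 l0 (@is_derive_osc2 _ t phi).
have lip u v : lo x <= u -> u <= v -> v <= hi x ->
    `|osc1 t phi v - osc1 t phi u| <= 2 * K * x `^ theta.
  move=> lu uv vh; apply: (@le_trans _ _ (1 * (v - u))); last first.
    by rewrite mul1r; move: lu vh; rewrite /lo /hi; lra.
  apply: (@mean_value_le _ _ (osc t phi)) => // z.
    by move=> /andP[uz _]; apply: is_derive_osc1; apply: lt_le_trans uz;
      apply: lt_le_trans lu.
  by move=> _; exact: norm_osc_le.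
have L1 := lip _ _ lc ch (lexx _).
have L2 := lip _ _ (lexx _) lc ch.
have p0 : 0 < x `^ theta by exact: powR_gt0.
have q1 : x `^ (theta - 1) = x `^ theta / x.
  by rewrite powRB ?(gt_eqF x0) ?implybT// powRr1// ltW.
rewrite /hi' /lo' /secant q1.
set oh := osc1 t phi (hi x) in L1 *; set ol := osc1 t phi (lo x) in L2 *.
set oc := osc1 t phi c in L1 L2 *; set p := x `^ theta in p0 L1 L2 *.
have -> : A * ((oh * (A^-1 + K * (theta * (p / x))) -
    ol * (A^-1 - K * (theta * (p / x)))) / (2 * K * p) - theta / x * oc) -
    (oh - ol) / (2 * K * p) =
   A * theta / x * (((oh - oc) - (oc - ol)) / 2).
  by field; rewrite !gt_eqF.
have -> : 2 * A * K * (p / x) = A / x * (2 * K * p) by ring.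
rewrite normrM ler_pM//.
  rewrite ger0_norm; last by rewrite !mulr_ge0 ?invr_ge0 ?ltW.
  rewrite -mulrA ler_pM2l// ler_piMl ?(ltW theta1)//.
  by rewrite invr_ge0 ltW.
rewrite normrM (ger0_norm (x := 2^-1)) ?invr_ge0// ler_pdivrMr//.
by apply: (le_trans (ler_normB _ _)); lra.
Qed.

(* Up to O(y ^ (theta - 1)), the derivative of [A * secant (osc2 t phi)] is
   [secant (osc1 t phi)]; hence the telescoping. *)
Lemma step_secant t phi (j : nat) : (j0 <= j)%N ->
  `|A * secant (osc2 t phi) j.+1%:R - A * secant (osc2 t phi) j%:R
    - secant (osc1 t phi) j%:R|
  <= 2 * A * K * j%:R `^ (theta - 1)
     + ((A * K)^-1 + 2) * j%:R `^ (1 - theta - 1).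
Proof.
move=> j0j; have jj : (j0%:R : R) <= j%:R by rewrite ler_nat.
have js : (j.+1%:R : R) = j%:R + 1 by rewrite -natr1.
have [|x /andP[jx _]|c /andP[jc cj]] :=
  @mean_value R (fun y => A * secant (osc2 t phi) y) (fun x =>
  A * ((osc1 t phi (hi x) * hi' x - osc1 t phi (lo x) * lo' x)
      / (2 * K * x `^ theta) - theta / x * secant (osc2 t phi) x)) j%:R j.+1%:R.
- by rewrite ler_nat.
- have xj := le_trans jj jx.
  have d : is_derive x (1 : R^o) (secant (osc2 t phi))
    ((osc1 t phi (hi x) * hi' x - osc1 t phi (lo x) * lo' x)
      / (2 * K * x `^ theta) - theta / x * secant (osc2 t phi) x).
    apply: is_derive_secant; last exact: is_derive_osc2.
    + exact: lt_le_trans (ge1_large xj).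
    + exact: lt_le_trans (lo_ge1 xj).
  exact: is_deriveZ d.
rewrite [X in _ * (X - _)]js addrAC subrr add0r mulr1 => ->.
have cj0 := le_trans jj jc.
have c0 : 0 < c by apply: lt_le_trans (ge1_large cj0).
have j00 : 0 < j%:R :> R by apply: lt_le_trans (ge1_large jj).
set D := A * _; set Fc := secant (osc1 t phi) c.
(* [D] is the derivative at the intermediate point [c]; it is compared with the secant slope first
   at [c], then at j. *)
have -> : D - secant (osc1 t phi) j%:R = (D - Fc) + (Fc - secant (osc1 t phi) j%:R).
  by ring.
apply: (le_trans (ler_normD _ _)); rewrite lerD//.
  apply: (le_trans (dist_derive_secant_osc2_le t phi cj0)).
  rewrite -[theta - 1]opprB ler_wpM2l ?powRN_le ?subr_ge0 ?(ltW theta1)//.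
  by rewrite !mulr_ge0 ?ltW.
(* The bound is stated with the exponent [1 - theta - 1] so as to fit [sum_powR_le]. *)
have -> : 1 - theta - 1 = - theta by ring.
by apply: dist_secant_osc1_le; rewrite // -js.
Qed.

(** Telescoping with [Phi]: [T1] collects the errors of the steps, [T2] replaces the last term by A
    times [osc1] at the centre of its window, and [T3] bounds the fixed first term. *)
Lemma sum_secant : exists C : R, forall t phi (n : nat), (j0 <= n)%N ->
  `|\sum_(j0 <= j < n) secant (osc1 t phi) j%:R - A * osc1 t phi (n%:R / A)|
  <= C * (n%:R `^ theta + n%:R `^ (1 - theta)).
Proof.
pose C1 := 2 * A * K; pose C2 := (A * K)^-1 + 2.
(* A c <= 2 [j0] for every c in the window of [j0], and |[osc1]| <= c at c. *)
pose C3 : R := 2 * j0%:R.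
have h1 : 0 < 1 - theta by rewrite subr_gt0.
have h2 : 1 - theta < 1 by rewrite gtrBl.
have C10 : 0 <= C1 by rewrite !mulr_ge0 ?ltW.
have C20 : 0 <= C2 by rewrite addr_ge0// invr_ge0 mulr_ge0 ?ltW.
exists (C1 / theta + C2 / (1 - theta) + A * K + C3) => t phi n j0n.
have nj : (j0%:R : R) <= n%:R by rewrite ler_nat.
have n1 := ge1_large nj; have n0 : 0 < n%:R :> R by exact: lt_le_trans n1.
pose Phi (j : nat) := A * secant (osc2 t phi) j%:R.
have osc2E y : j0%:R <= y -> exists2 c, lo y <= c <= hi y &
    A * secant (osc2 t phi) y = A * osc1 t phi c.
  move=> yj; have [||c cP ->] := @secant_mean _ _ y _ _ (@is_derive_osc2 _ t phi).
  - exact: lt_le_trans (ge1_large yj).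
  - exact: lt_le_trans (lo_ge1 yj).
  - by exists c.
have T1 : `|\sum_(j0 <= j < n) secant (osc1 t phi) j%:R - (Phi n - Phi j0)| <=
    C1 * (n%:R `^ theta / theta) + C2 * (n%:R `^ (1 - theta) / (1 - theta)).
  rewrite -(telescope_sumr _ j0n) -sumrB.
  apply: (le_trans (ler_norm_sum _ _ _)).
  apply: (@le_trans _ _ (\sum_(j0 <= j < n) (C1 * j%:R `^ (theta - 1) +
     C2 * j%:R `^ (1 - theta - 1)))).
    by apply: ler_sum_nat => j /andP[j0j _]; rewrite distrC; exact: step_secant.
  by rewrite big_split/= -!mulr_sumr lerD// ler_wpM2l// sum_powR_le.
have T2 : `|Phi n - A * osc1 t phi (n%:R / A)| <= A * K * n%:R `^ theta.
  have [c /andP[lc ch] E] := osc2E _ nj.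
  have c0 : 0 < c by apply: lt_le_trans lc; apply: lt_le_trans (lo_ge1 nj).
  rewrite /Phi E -mulrBr normrM gtr0_norm// -mulrA ler_pM2l//.
  move: lc ch; rewrite /lo /hi; set u := n%:R / A => lc ch.
  have u0 : 0 < u by rewrite divr_gt0.
  have lip v w : 0 < v -> v <= w -> `|osc1 t phi w - osc1 t phi v| <= w - v.
    move=> v0 vw; rewrite -[leRHS]mul1r; apply: (@mean_value_le _ _ (osc t phi)) => // z.
      by move=> /andP[vz _]; apply: is_derive_osc1; apply: lt_le_trans vz.
    by move=> _; exact: norm_osc_le.
  have [cu|/ltW uc] := leP c u.
    by rewrite distrC; apply: (le_trans (lip _ _ c0 cu)); lra.
  by apply: (le_trans (lip _ _ u0 uc)); lra.
have T3 : `|Phi j0| <= C3.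
  have [c /andP[lc ch] E] := osc2E _ (lexx _).
  have c0 : 0 <= c by apply: le_trans lc; apply: le_trans (lo_ge1 (lexx _)).
  rewrite /Phi E normrM gtr0_norm//.
  apply: (@le_trans _ _ (A * c)); first by rewrite ler_pM2l// norm_osc1_le.
  have [kj _] := j0P (lexx _).
  apply: (@le_trans _ _ (A * (2 * (j0%:R / A)))).
    rewrite ler_pM2l//; apply: (le_trans ch); rewrite /hi.
    have -> : j0%:R / A = 2 * (j0%:R / (2 * A)) by field; rewrite gt_eqF.
    have : 0 <= j0%:R / (2 * A) by rewrite divr_ge0// mulr_ge0 ?ltW.
    by lra.
  rewrite /C3; suff -> : A * (2 * (j0%:R / A)) = 2 * j0%:R by [].
  by field; rewrite gt_eqF.
set S := \sum_(_ <= _ < _) _ in T1 *.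
set G := A * osc1 _ _ _ in T2 *.
have -> : S - G = (S - (Phi n - Phi j0)) + (Phi n - G) - Phi j0 by ring.
apply: (le_trans (ler_normB _ _)); apply: (le_trans (lerD (ler_normD _ _) (lexx _))).
apply: (le_trans (lerD (lerD T1 T2) T3)).
set p := n%:R `^ theta; set q := n%:R `^ (1 - theta).
have p1 : 1 <= p by rewrite -[leLHS](powRr0 n%:R) ler_powR// ltW.
have q1 : 0 <= q by rewrite powR_ge0.
have a1 : 0 <= C1 / theta by rewrite divr_ge0// ltW.
have a2 : 0 <= C2 / (1 - theta) by rewrite divr_ge0// ltW.
have a3 : 0 <= A * K by rewrite mulr_ge0 ?ltW.
have a4 : 0 <= C3 by rewrite /C3 mulr_ge0.
have -> : C1 * (p / theta) = C1 / theta * p by ring.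
have -> : C2 * (q / (1 - theta)) = C2 / (1 - theta) * q by ring.
by nra.
Qed.

End MeanValues.

(** * Comparison of {j | n_j <= x} with [1, A x], for a fixed outcome *)

Section Indices.
Context {R : realType}.
Variables A K theta : R.
Hypotheses (A0 : 0 < A) (K0 : 0 < K) (theta0 : 0 < theta) (theta1 : theta < 1).
Implicit Types (s : nat -> R) (x t : R).

(** All that the deterministic estimates use of a sample sequence; it holds for every outcome, not
    only almost surely. *)
Definition in_windows s := forall j, (0 < j)%N ->
  sel_lo A K theta j < s j <= sel_hi A K theta j.

Lemma in_windows_gt0 s j : in_windows s -> (0 < j)%N -> 0 < s j.
Proof.
move=> sw j0; have /andP[+ _] := sw _ j0; apply: le_lt_trans.
by rewrite /sel_lo le_max lexx.
Qed.

(** In both directions j = O(x), so that the half-width K j ^ theta is O(x ^ theta). *)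
Lemma index_window : exists2 C : R, 0 <= C & forall s, in_windows s ->
  forall x, 1 <= x -> forall j, (0 < j)%N ->
    (s j <= x -> j%:R <= A * x + C * x `^ theta) /\
    (j%:R <= A * x - C * x `^ theta -> s j <= x).
Proof.
have [j0 j01 j0P] := powR_theta_small A0 K0 theta1.
(* If s j <= x then j <= [B] x: either j < [j0] <= [j0] x, or j / (2 A) is at most the lower end of
   the window, hence at most x. *)
pose B := 2 * A + j0%:R.
have B0 : 0 <= B by rewrite addr_ge0// mulr_ge0// ltW.
exists (A * K * B `^ theta) => [|s sw x x1 j jgt0].
  by rewrite !mulr_ge0 ?powR_ge0 ?ltW.
have x0 : 0 < x by exact: lt_le_trans x1.
have jB : j%:R <= B * x -> A * (K * j%:R `^ theta) <= A * K * B `^ theta * x `^ theta.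
  move=> jx; rewrite -!mulrA ler_pM2l// ler_pM2l// -powRM// ?(ltW x0)//.
  by apply: ge0_ler_powR; rewrite // ?nnegrE ?mulr_ge0// ltW.
have /andP[sl sh] := sw _ jgt0; split=> sx.
- have lox : j%:R / A - K * j%:R `^ theta <= x.
    by apply: le_trans sx; apply/ltW; apply: le_lt_trans sl;
      rewrite /sel_lo le_max lexx orbT.
  have jBx : j%:R <= B * x.
    have [jj|jj] := leP j0%:R (j%:R : R).
      have [h _] := j0P _ jj.
      have E : j%:R / A = 2 * (j%:R / (2 * A)) by field; rewrite gt_eqF.
      have : j%:R / (2 * A) <= x by lra.
      rewrite ler_pdivrMr ?mulr_gt0// => h2.
      have := mulr_ge0 (ler0n R j0) (ltW x0); rewrite /B; lra.
    have : (j0%:R : R) <= j0%:R * x by rewrite ler_peMr.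
    have := mulr_ge0 (ltW A0) (ltW x0); rewrite /B; lra.
  apply: (@le_trans _ _ (A * x + A * (K * j%:R `^ theta))); last by rewrite lerD2l jB.
  rewrite -mulrDr -ler_pdivrMl// mulrC; lra.
- apply: (le_trans sh); rewrite /sel_hi.
  have Cx : 0 <= A * K * B `^ theta * x `^ theta by rewrite !mulr_ge0 ?powR_ge0 ?ltW.
  have : j%:R <= B * x.
    have := mulr_ge0 (ler0n R j0) (ltW x0).
    have := mulr_ge0 (ltW A0) (ltW x0); rewrite /B; lra.
  move=> /jB h; rewrite -(ler_pM2l A0) mulrDr mulrCA mulfV ?gt_eqF// mulr1; lra.
Qed.

(** The index set need not be an initial segment; the bound [m] makes it a filtered integer
    interval, so that sums over it are ordinary finite sums. *)
Lemma indices_le_bounded s x (m : nat) :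
  (forall j, (0 < j)%N -> s j <= x -> (j < m)%N) ->
  indices_le s x = [set` [seq j <- index_iota 1 m | s j <= x]].
Proof.
move=> sm; apply/seteqP; split=> j /=.
  by move=> [jgt0 sx]; rewrite mem_filter sx mem_index_iota jgt0 (sm j).
by rewrite mem_filter mem_index_iota => /and3P[sx j1 _]; split.
Qed.

Lemma indices_le_finite s x (m : nat) :
  (forall j, (0 < j)%N -> s j <= x -> (j < m)%N) -> finite_set (indices_le s x).
Proof. by move=> /indices_le_bounded ->; exact: finite_seq. Qed.

Lemma sum_indices_le (V : nmodType) (f : nat -> V) s x (m : nat) :
  (forall j, (0 < j)%N -> s j <= x -> (j < m)%N) ->
  \sum_(j \in indices_le s x) f j = \sum_(1 <= j < m | s j <= x) f j.
Proof.
move=> /indices_le_bounded ->.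
by rewrite -fsbig_seq ?filter_uniq ?iota_uniq// big_filter.
Qed.

Lemma counting_funE s x (m : nat) :
  (forall j, (0 < j)%N -> s j <= x -> (j < m)%N) ->
  (counting_fun s x)%:R = \sum_(j \in indices_le s x) (1 : R).
Proof.
move=> sm; rewrite fsbig_finite; last exact: indices_le_finite sm.
by rewrite /counting_fun big_const_seq count_predT iter_addr_0 cardfE.
Qed.

(** Indices up to [L] occur in both sums and those from [m] on in neither; each of the O(x ^ theta)
    indices in between contributes at most 1. *)
Lemma sum_indices_near : exists C : R, forall s, in_windows s ->
  forall x, 1 <= x -> exists2 m : nat,
    (forall j, (0 < j)%N -> s j <= x -> (j < m)%N) &
    forall f : nat -> R, (forall j, (0 < j)%N -> `|f j| <= 1) ->
    `|\sum_(j \in indices_le s x) f j - \sum_(1 <= j < (Num.truncn (A * x)).+1) f j|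
    <= C * x `^ theta.
Proof.
have [C C0 CP] := index_window; exists (2 * C + 1) => s sw x x1.
have x0 : 0 < x by exact: lt_le_trans x1.
have Cx : 0 <= C * x `^ theta by rewrite mulr_ge0 ?powR_ge0.
have Ax : 0 < A * x by rewrite mulr_gt0.
pose m := (Num.truncn (A * x + C * x `^ theta)).+1.
have sm j : (0 < j)%N -> s j <= x -> (j < m)%N.
  move=> jgt0 /(proj1 (CP s sw x x1 j jgt0)) h.
  by rewrite /m ltnS truncn_ge_nat// addr_ge0// ltW.
exists m => // f f1.
rewrite (sum_indices_le _ sm).
set J := Num.truncn (A * x).
have Jm : (J.+1 <= m)%N by rewrite ltnS le_truncn// lerDl.
have -> : \sum_(1 <= j < J.+1) f j = \sum_(1 <= j < m | (j < J.+1)%N) f j.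
  by rewrite (big_nat_widen _ _ _ _ _ Jm).
rewrite big_mkcond/= [X in _ - X]big_mkcond/= -sumrB.
(* If the argument is negative then [L] is 0, and no index is claimed to occur in both sums. *)
pose L := Num.truncn (A * x - C * x `^ theta).
have Lm : (L.+1 <= m)%N.
  by rewrite ltnS le_truncn// lerD2l (le_trans _ Cx)// oppr_le0.
apply: (le_trans (ler_norm_sum _ _ _)).
apply: (@le_trans _ _ (\sum_(1 <= j < m) (L < j)%N%:R)).
  apply: ler_sum_nat => j /andP[jgt0 jm].
  have [Lj|jL] := ltnP L j.
    by case: ifP => _; case: ifP => _; rewrite ?subrr ?subr0 ?sub0r ?normrN ?normr0 ?f1.
  have jx : j%:R <= A * x - C * x `^ theta.
    by rewrite -(prednK jgt0) -truncn_gt_nat prednK.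
  have sj := proj2 (CP s sw x x1 j jgt0) jx.
  have jJ : (j < J.+1)%N.
    by rewrite ltnS /J truncn_ge_nat ?(ltW Ax)//; lra.
  by rewrite sj jJ subrr normr0.
have -> : \sum_(1 <= j < m) (L < j)%N%:R = (m - L.+1)%N%:R :> R.
  rewrite (big_cat_nat _ Lm)//= big_nat_cond big1 ?add0r; last first.
    by move=> j /andP[/andP[_ jL] _]; rewrite ltnNge -ltnS jL.
  rewrite (eq_big_nat _ _ (F2 := fun=> 1)); last by move=> j /andP[->].
  by rewrite sumr_const_nat.
rewrite natrB// /m -!natr1.
have mE : (Num.truncn (A * x + C * x `^ theta))%:R <= A * x + C * x `^ theta.
  by rewrite truncn_le// addr_ge0// ltW.
have LE : A * x - C * x `^ theta < L%:R + 1 by rewrite natr1 truncnS_gt.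
have x1t : 1 <= x `^ theta by rewrite -[leLHS](powRr0 x) ler_powR// ltW.
by lra.
Qed.

End Indices.

(** * The sum of the means up to a real bound *)

Section MeanValuesAt.
Context {R : realType}.
Variables A K theta : R.
Hypotheses (A0 : 0 < A) (K0 : 0 < K) (theta0 : 0 < theta) (theta1 : theta < 1).
Variable j0 : nat.
Hypothesis j01 : (1 < j0)%N.
Hypothesis j0P : forall y : R, j0%:R <= y -> K * y `^ theta <= y / (2 * A) /\ 2 * A <= y.

(** With n = floor (A x) + 1 the point n / A is within 1 / A of x, and [osc1] is 1-Lipschitz. If n <
    [j0], the sum is empty and A x < [j0]. *)
Lemma sum_secant_at : exists C : R, forall t phi x, 1 <= x ->
  `|\sum_(j0 <= j < (Num.truncn (A * x)).+1) secant A K theta (osc1 t phi) j%:R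
    - A * osc1 t phi x| <= C * (x `^ theta + x `^ (1 - theta)).
Proof.
have [C CP] := sum_secant A0 K0 theta0 theta1 j01 j0P.
pose B := A + 1.
have B1 : 1 <= B by rewrite lerDr ltW.
exists (`|C| * B + 1 + j0%:R) => t phi x x1.
have x0 : 0 < x by exact: lt_le_trans x1.
have Ax : 0 < A * x by rewrite mulr_gt0.
set n := (Num.truncn (A * x)).+1.
have nl : A * x < n%:R by rewrite truncnS_gt.
have nu : n%:R <= A * x + 1 by rewrite -natr1 lerD2r truncn_le ltW.
have t1 : 0 < 1 - theta by rewrite subr_gt0.
set p := x `^ theta; set q := x `^ (1 - theta).
have p1 : 1 <= p by rewrite -[leLHS](powRr0 x) ler_powR// ltW.
have q1 : 1 <= q by rewrite -[leLHS](powRr0 x) ler_powR// ltW.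
have Bn0 : 0 <= `|C| * B by rewrite mulr_ge0// (le_trans _ B1).
have j00 : (0 : R) <= j0%:R by [].
have [nj|jn] := ltnP n j0.
  rewrite big_geq; last exact: ltnW.
  rewrite sub0r normrN normrM (gtr0_norm A0).
  apply: (@le_trans _ _ j0%:R); last by nra.
  apply: (@le_trans _ _ (A * x)).
    by rewrite ler_pM2l// norm_osc1_le ?ltW.
  by apply: (le_trans (ltW nl)); rewrite ler_nat ltnW.
have nB a : 0 <= a -> a <= 1 -> n%:R `^ a <= B * x `^ a.
  move=> a0 a1; apply: (@le_trans _ _ ((B * x) `^ a)).
    apply: ge0_ler_powR; rewrite ?nnegrE//; first by rewrite mulr_ge0 ?ltW// (lt_le_trans _ B1).
    by rewrite /B; lra.
  rewrite powRM ?(ltW x0)// ?(le_trans _ B1)// ler_wpM2r ?powR_ge0//.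
  by rewrite -[leRHS]powRr1 ?(le_trans _ B1)// ler_powR.
have := CP t phi n jn; set S := \sum_(_ <= _ < _) _.
move=> h.
have h2 : `|osc1 t phi (n%:R / A) - osc1 t phi x| <= A^-1.
  have xn : x <= n%:R / A by rewrite ler_pdivlMr// mulrC ltW.
  apply: (@le_trans _ _ (1 * (n%:R / A - x))).
    apply: (@mean_value_le _ _ (osc t phi)) => // z.
      by move=> /andP[xz _]; apply: is_derive_osc1; apply: lt_le_trans xz.
    by move=> _; exact: norm_osc_le.
  rewrite mul1r lerBlDr ler_pdivrMr// mulrDl mulVf ?gt_eqF//; lra.
have -> : S - A * osc1 t phi x =
    (S - A * osc1 t phi (n%:R / A)) + A * (osc1 t phi (n%:R / A) - osc1 t phi x).
  by ring.
apply: (le_trans (ler_normD _ _)).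
rewrite normrM (gtr0_norm A0).
have h3 : A * `|osc1 t phi (n%:R / A) - osc1 t phi x| <= 1.
  by rewrite -ler_pdivlMl// mulr1.
have h4 : C * (n%:R `^ theta + n%:R `^ (1 - theta)) <= `|C| * B * (p + q).
  apply: (@le_trans _ _ (`|C| * (n%:R `^ theta + n%:R `^ (1 - theta)))).
    by rewrite ler_wpM2r ?ler_norm// addr_ge0 ?powR_ge0.
  rewrite -mulrA ler_wpM2l// mulrDr.
  have h0 : 1 - theta <= 1 by rewrite gerBl ltW.
  by apply: lerD; apply: nB; rewrite ?(ltW theta0) ?(ltW theta1) ?(ltW t1).
by nra.
Qed.

End MeanValuesAt.

(** * Real and imaginary parts of complex powers *)

Section ComplexParts.
Context {R : realType}.
Implicit Types (t u x : R) (z : R[i]).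

Lemma normc_le z : Normc.normc z <= `|complex.Re z| + `|complex.Im z|.
Proof.
case: z => a b /=; rewrite -[leRHS]ger0_norm ?addr_ge0// -sqrtr_sqr ler_wsqrtr//.
by rewrite sqrrD !real_normK ?num_real// addrAC lerDl mulrn_wge0// mulr_ge0.
Qed.

Lemma Re_cpowR t u : complex.Re (cpowR u (0 -i* t)) = osc t 0 u.
Proof. by rewrite /cpowR /osc/= mul0r expR0 mul1r mul0r subr0 addr0 mulNr cosN. Qed.

Lemma Im_cpowR t u : complex.Im (cpowR u (0 -i* t)) = osc t (pi / 2) u.
Proof.
by rewrite /cpowR /osc/= mul0r expR0 mul1r mul0r addr0 mulNr sinN cosDpihalf.
Qed.

Lemma cpowR_antideriv (A : R) t x : 0 < x ->
  A%:C * cpowR x (1 -i* t) / (1 -i* t)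
  = (A * osc1 t 0 x) +i* (A * osc1 t (pi / 2) x).
Proof.
move=> x0; have t0 : 1 + t ^+ 2 != 0 by rewrite gt_eqF// ltr_pwDl// sqr_ge0.
have n0 : (1 -i* t : R[i]) != 0 by rewrite eq_complex/= oner_eq0.
apply: (mulIf n0); rewrite divfK// /cpowR /osc1 mulNr cosN sinN mul1r lnK//.
rewrite addr0 cosDpihalf sinDpihalf; set c := cos _; set s := sin _.
by apply/eqP; rewrite eq_complex/=; apply/andP; split; apply/eqP; field.
Qed.

End ComplexParts.

(** * Expectations of products of independent variables *)

Section Independence.
Context {R : realType} {d : measure_display} {T : measurableType d}.
Variable P : probability T R.
Implicit Types (S : T -> R) (f : R -> R).
Local Open Scope ereal_scope.
Import HBNNSimple.

(** Decomposition by the finitely many values of h; it serves both for [S] and for the constant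
    1. *)
Let integral_mul_nnsfun S (X : {RV P >-> R}) (h : {nnsfun R >-> R}) :
  measurable_fun setT S -> (forall w, 0 <= S w)%R ->
  \int[P]_w (S w * h (X w))%:E =
  \sum_(r \in range h) r%:E * \int[P]_(w in X @^-1` (h @^-1` [set r])) (S w)%:E.
Proof.
move=> mS S0.
have mr r : measurable (h @^-1` [set r]) by exact: measurable_sfunP.
have mXr r : measurable (X @^-1` (h @^-1` [set r])).
  by rewrite -[X in measurable X]setTI; exact: measurable_funPT.
under [LHS]eq_integral => w _.
  rewrite [h _]fimfunE EFinM -fsumEFin// ge0_mule_fsumr; last first.
    by move=> r; rewrite EFinM nnfun_muleindic_ge0.
  over.
rewrite ge0_integral_fsum//; last 2 first.
- move=> r; apply/measurable_EFinP/measurable_funM => //.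
  apply: measurable_funM => //.
  by apply: measurableT_comp => //; exact: measurable_indic.
- move=> r w _; apply: mule_ge0; first by rewrite lee_fin.
  by rewrite EFinM nnfun_muleindic_ge0.
apply: eq_fsbigr => r; rewrite inE => -[u _ hur].
rewrite [in RHS]integral_mkcond -ge0_integralZl//.
- apply: eq_integral => w _; rewrite patchE -EFinM indicE.
  case: ifPn => wr.
    have -> : X w \in h @^-1` [set r] by rewrite inE; move: wr; rewrite inE.
    by rewrite mulr1 mulrC.
  have -> : (X w \in h @^-1` [set r]) = false.
    by apply: contraNF wr; rewrite !inE.
  by rewrite !mulr0 mule0.
- apply/(measurable_restrictT _ _).1 => //.
  by apply/measurable_EFinP; exact: measurable_funTS.
- by move=> w _; rewrite patchE; case: ifPn => // _; rewrite lee_fin.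
- by rewrite lee_fin -hur.
Qed.

(** The hypothesis on [S] is the claim for indicators f. It extends to simple functions by linearity
    and to nonnegative f by monotone convergence. *)
Lemma integral_mul_factor S (X : {RV P >-> R}) f (c : R) :
  measurable_fun setT S -> (forall w, 0 <= S w)%R -> (0 <= c)%R ->
  (forall B, measurable B ->
    \int[P]_(w in X @^-1` B) (S w)%:E = c%:E * P (X @^-1` B)) ->
  measurable_fun setT f -> (forall u, 0 <= f u)%R ->
  \int[P]_w (S w * f (X w))%:E = c%:E * \int[P]_w (f (X w))%:E.
Proof.
move=> mS S0 c0 Sc mf f0.
have mEf : measurable_fun [set: R] (EFin \o f).
  exact/measurable_EFinP.
pose h := nnsfun_approx measurableT mEf.
have simple n : \int[P]_w (S w * h n (X w))%:E = c%:E * \int[P]_w (h n (X w))%:E.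
  rewrite integral_mul_nnsfun//.
  under [in RHS]eq_integral => w _ do rewrite -[X in X%:E]mul1r.
  rewrite (@integral_mul_nnsfun (cst 1%R))// ge0_mule_fsumr; last first.
    move=> r; have [[u _ hur]|nr] := pselect (range (h n) r).
      by rewrite mule_ge0 ?lee_fin -?hur// integral_ge0// => w _; rewrite lee_fin.
    rewrite (_ : h n @^-1` [set r] = set0).
      by rewrite preimage_set0 integral_set0 mule0.
    by apply/seteqP; split => // u hur; apply: nr; exists u.
  apply: eq_fsbigr => r _; rewrite Sc; last exact: measurable_sfunP.
  rewrite (_ : \int[P]_(w in _) _ = P (X @^-1` (h n @^-1` [set r]))) 1?muleCA//.
  rewrite (eq_integral (cst 1))// integral_cst ?mul1e//.
  by rewrite -[X in measurable X]setTI; apply: measurable_funPT.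
have hcvg (w : T) : (h n (X w))%:E @[n --> \oo] --> (f (X w))%:E.
  by apply: (@cvg_nnsfun_approx _ _ _ _ measurableT _ mEf) => // u _; rewrite lee_fin.
have mh n : measurable_fun setT (fun w => h n (X w)) by apply: measurableT_comp.
have L : \int[P]_w (S w * h n (X w))%:E @[n --> \oo] --> \int[P]_w (S w * f (X w))%:E.
  rewrite [X in _ --> X](_ : _ = \int[P]_w limn (fun n => (S w * h n (X w))%:E)); last first.
    apply: eq_integral => w _; apply/esym/cvg_lim => //.
    under eq_fun do rewrite EFinM.
    by rewrite EFinM; apply: cvgeZl.
  apply: cvg_monotone_convergence => //.
  - by move=> n; apply/measurable_EFinP; exact: measurable_funM.
  - by move=> n w _; rewrite lee_fin mulr_ge0.
  - move=> w _ m n mn; rewrite lee_fin ler_wpM2l//.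
    exact/lefP/nd_nnsfun_approx.
have L2 : \int[P]_w (h n (X w))%:E @[n --> \oo] --> \int[P]_w (f (X w))%:E.
  rewrite [X in _ --> X](_ : _ = \int[P]_w limn (fun n => (h n (X w))%:E)); last first.
    by apply: eq_integral => w _; apply/esym/cvg_lim.
  apply: cvg_monotone_convergence => //.
  - by move=> n; apply/measurable_EFinP.
  - by move=> n w _; rewrite lee_fin.
  - by move=> w _ m n mn; rewrite lee_fin; exact/lefP/nd_nnsfun_approx.
have L3 : c%:E * \int[P]_w (h n (X w))%:E @[n --> \oo] -->
    c%:E * \int[P]_w (f (X w))%:E by apply: cvgeZl.
by move: L; under eq_fun do rewrite simple; move=> L; apply: (cvg_unique _ L L3).
Qed.

Variables (J : set nat) (X : nat -> {RV P >-> R}).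
Hypothesis indep : mutually_independent J X.
Variables (f : nat -> R -> R) (m : nat -> R).
Hypotheses (mf : forall i, measurable_fun setT (f i))
  (f0 : forall i u, (0 <= f i u)%R)
  (fm : forall i, J i -> \int[P]_w (f i (X i w))%:E = (m i)%:E).

Let event (F : {fset nat}) (B : nat -> set R) : set T :=
  \bigcap_(i in [set` F]) (X i @^-1` B i).

Let measurable_event F B : (forall i, i \in F -> measurable (B i)) ->
  measurable (event F B).
Proof.
move=> mB; apply: bigcap_measurableType => i iF.
by rewrite -[X in measurable X]setTI; apply: measurable_funPT => //; exact: mB.
Qed.

Let measurable_prod_f (s : seq nat) :
  measurable_fun setT (fun w => \prod_(i <- s) f i (X i w))%R.
Proof.
elim: s => [|i s IHs]; first by under eq_fun do rewrite big_nil; exact: measurable_cst.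
under eq_fun do rewrite big_cons.
by apply: measurable_funM => //; apply: measurableT_comp.
Qed.

(** Induction on s. The event on the separate indices [F] is what makes the induction work: to split
    off the factor of index i, the remaining product is tested on events in [X i], which is the
    induction hypothesis for [F] enlarged by i. *)
Lemma integral_prod_event (s : seq nat) (F : {fset nat}) (B : nat -> set R) :
  uniq s -> [set` s] `<=` J -> [set` F] `<=` J ->
  (forall i, i \in F -> measurable (B i)) ->
  (forall i, i \in s -> i \notin F) ->
  \int[P]_(w in event F B) (\prod_(i <- s) f i (X i w))%:E =
  (\prod_(i <- s) m i)%:E * P (event F B).
Proof.
elim: s F B => [|i s IHs] F B.
  move=> _ _ _ mB _; under eq_integral do rewrite big_nil.
  by rewrite big_nil integral_cst ?mul1e//; exact: measurable_event.
move=> /= /andP[is_ us] sJ FJ mB sF.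
have mD := measurable_event mB.
have iF : i \notin F by apply: sF; rewrite inE eqxx.
have Ji : J i by apply: sJ => /=; rewrite inE eqxx.
have m0 k : J k -> (0 <= m k)%R.
  by move=> Jk; rewrite -lee_fin -fm//; apply: integral_ge0 => w _; rewrite lee_fin.
pose D := event F B.
pose S w := (\prod_(k <- s) f k (X k w) * \1_D w)%R.
have PD : P D = (fine (P D))%:E by rewrite fineK// fin_num_measure.
rewrite integral_mkcond.
transitivity (\int[P]_w (S w * f i (X i w))%:E).
  apply: eq_integral => w _; rewrite patchE /S indicE big_cons -/D.
  case: ifPn => wD /=; first by rewrite mulr1 mulrC.
  by rewrite mulr0 mul0r.
rewrite (@integral_mul_factor _ _ _ (\prod_(k <- s) m k * fine (P D)))//.
- by rewrite fm// big_cons EFinM -PD -/D [in RHS]EFinM muleC muleA.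

- by apply: measurable_funM => //; exact: measurable_indic.
- by move=> w; rewrite /S mulr_ge0// prodr_ge0.
- rewrite mulr_ge0 ?fine_ge0//.
  rewrite big_seq prodr_ge0// => k ks; apply: m0; apply: sJ => /=.
  by rewrite inE ks orbT.
move=> B' mB'.
pose B2 k := if k == i then B' else B k.
have iFJ : [set` (i |` F)%fset] `<=` J.
  by move=> k /=; rewrite !inE => /predU1P[->//|kF]; exact: FJ.
have mB2 k : k \in (i |` F)%fset -> measurable (B2 k).
  by rewrite !inE /B2; case: eqP => //= _; exact: mB.
have E2 : event (i |` F)%fset B2 = X i @^-1` B' `&` D.
  apply/seteqP; split=> w /=.
    move=> wE; split.
      by have := wE i; rewrite /= !inE eqxx /B2 eqxx; apply.
    move=> k /= kF; have := wE k; rewrite /= !inE kF orbT /B2.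
    by case: eqP => [ki|_]; [move: iF; rewrite -ki kF|apply].
  move=> [wB wD] k /=; rewrite !inE /B2; case: eqP => [->//|_ /= kF].
  exact: (wD k kF).
transitivity (\int[P]_(w in event (i |` F)%fset B2)
    (\prod_(k <- s) f k (X k w))%:E).
  rewrite E2 integral_mkcondr; apply: eq_integral => w _.
  rewrite patchE /S indicE.
  by case: ifPn => wD; rewrite ?mulr1 ?mulr0.
rewrite IHs//; last 2 first.
- by move=> k /= ks; apply: sJ => /=; rewrite inE ks orbT.
- move=> k ks; rewrite !inE negb_or sF ?inE ?ks ?orbT// andbT.
  by apply: contra is_ => /eqP <-.
(* Independence is used twice, for the enlarged index set and for [F]. *)
have -> : P (event (i |` F)%fset B2) = P D * P (X i @^-1` B').
  rewrite indep// big_fsetU1//= {1}/B2 eqxx muleC; congr (_ * _).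
  rewrite indep//; rewrite !big_seq; apply: eq_bigr => k kF; rewrite /B2.
  by case: eqP => // ki; move: iF; rewrite -ki kF.
by rewrite EFinM -PD muleA.
Qed.

Lemma integral_prod (s : seq nat) : uniq s -> [set` s] `<=` J ->
  \int[P]_w (\prod_(i <- s) f i (X i w))%:E = (\prod_(i <- s) m i)%:E.
Proof.
move=> us sJ; have := @integral_prod_event s fset0 (fun=> setT) us sJ.
rewrite [event _ _](_ : _ = setT); last first.
  by apply/seteqP; split => // w _ k.
by rewrite probability_setT mule1; apply => // i; rewrite inE.
Qed.

End Independence.

(** * A sub-Gaussian tail bound *)

Section Concentration.
Context {R : realType} {d : measure_display} {T : measurableType d}.
Variable P : probability T R.

(** For y > 1 the exponents compare directly; otherwise it is enough that e ^ y <= 1 + y + 2 y ^ 2.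
    The linear term will vanish in the mean. *)
Lemma expR_le_add_expR_sqr (y : R) : expR y <= y + expR (2 * y ^+ 2).
Proof.
have q := expR_ge1Dx (2 * y ^+ 2).
have y2 := sqr_ge0 y.
have inv_le (z : R) : z < 1 -> expR z <= (1 - z)^-1.
  move=> z1; rewrite -[z]opprK expRN lef_pV2 ?posrE ?expR_gt0 ?opprK ?subr_gt0//.
  exact: expR_ge1Dx.
have [y0|y0] := leP y 0.
  have [y1|y1] := leP y (-1).
    have : expR y <= 1 by rewrite expR_le1.
    by move: q; nra.
  have : expR y <= 1 + y + y ^+ 2.
    apply: (le_trans (inv_le y _)); first by lra.
    rewrite -[leLHS]mul1r ler_pdivrMr; last by lra.
    have -> : (1 + y + y ^+ 2) * (1 - y) = 1 - y * y ^+ 2 by ring.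
    by nra.
  by nra.
have [y1|y1] := leP y 1; last first.
  have : expR y <= expR (2 * y ^+ 2) by rewrite ler_expR; nra.
  by lra.
suff : expR y <= 1 + y + 2 * y ^+ 2 by lra.
(* Halving keeps the bound e ^ z <= 1 / (1 - z) finite up to y = 1. *)
have -> : expR y = expR (y / 2) ^+ 2 by rewrite -expRM_natl; congr expR; field.
have h : expR (y / 2) <= (1 - y / 2)^-1 by apply: inv_le; lra.
have h0 : 0 < 1 - y / 2 by lra.
apply: (@le_trans _ _ ((1 - y / 2) ^- 2)).
  by rewrite -exprVn ler_sqr ?nnegrE ?expR_ge0 ?invr_ge0// ltW.
rewrite -[leLHS]mul1r ler_pdivrMr ?exprn_gt0//.
have -> : (1 + y + 2 * y ^+ 2) * (1 - y / 2) ^+ 2 =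
  1 + y ^+ 2 / 2 * ((1 - y) * (5 / 2 - y)) by field.
by rewrite lerDl !mulr_ge0//; lra.
Qed.

Local Open Scope ereal_scope.

Let integral_cst_prob (c : R) : \int[P]_w c%:E = c%:E.
Proof. by rewrite integral_cst//= probability_setT mule1. Qed.

(** The hypothesis that [Y] has mean 0 is shifted by 2, and 2 l is added to both sides below, so
    that only nonnegative functions are integrated. *)
Lemma integral_expR_le (Y : T -> R) (l : R) : measurable_fun setT Y ->
  (forall w, `|Y w| <= 2)%R -> (0 <= l)%R ->
  \int[P]_w (Y w + 2)%:E = 2%:E ->
  \int[P]_w (expR (l * Y w))%:E <= (expR (8 * l ^+ 2))%:E.
Proof.
move=> mY Y2 l0 EY.
have mE : measurable_fun setT (fun w => expR (l * Y w)).
  by apply: measurableT_comp => //; exact: measurable_funM.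
have Yb w : (-2 <= Y w <= 2)%R by rewrite -ler_norml.
rewrite -(@leeD2rE _ (2 * l)%:E)//.
have -> : \int[P]_w (expR (l * Y w))%:E + (2 * l)%:E =
    \int[P]_w ((expR (l * Y w))%:E + (2 * l)%:E).
  rewrite ge0_integralD// ?integral_cst_prob//.
  - exact/measurable_EFinP.
  - by move=> w _; rewrite lee_fin mulr_ge0.
apply: (@le_trans _ _ (\int[P]_w (l%:E * (Y w + 2)%:E + (expR (8 * l ^+ 2))%:E))).
  apply: ge0_le_integral => //.
  - by move=> w _; rewrite -EFinD lee_fin addr_ge0 ?expR_ge0 ?mulr_ge0.
  - by apply: emeasurable_funD => //; exact/measurable_EFinP.
  - apply: emeasurable_funD => //; apply/measurable_EFinP.
    by apply: measurable_funM => //; exact: measurable_funD.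
  move=> w _; rewrite -EFinM -!EFinD lee_fin.
  have := expR_le_add_expR_sqr (l * Y w).
  have : (expR (2 * (l * Y w) ^+ 2) <= expR (8 * l ^+ 2))%R.
    rewrite ler_expR exprMn.
    have : (Y w ^+ 2 <= 4)%R by have /andP[] := Yb w; nra.
    by have := sqr_ge0 l; nra.
  by lra.
rewrite ge0_integralD//; last 2 first.
- move=> w _; rewrite -EFinM lee_fin mulr_ge0//.
  by have /andP[] := Yb w; lra.
- apply/measurable_EFinP.
  by apply: measurable_funM => //; exact: measurable_funD.
rewrite integral_cst_prob ge0_integralZl//; last 2 first.
- by apply/measurable_EFinP; exact: measurable_funD.
- by move=> w _; rewrite lee_fin; have /andP[] := Yb w; lra.
by rewrite EY -EFinM -!EFinD lee_fin; lra.
Qed.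

Variables (J : set nat) (X : nat -> {RV P >-> R}).
Hypothesis indep : mutually_independent J X.
Variables (g : nat -> R -> R).
Hypotheses (mg : forall i, measurable_fun setT (g i))
  (g2 : forall i u, (`|g i u| <= 2)%R)
  (Eg : forall i, J i -> \int[P]_w (g i (X i w) + 2)%:E = 2%:E).

(** Chernoff bound: exponential Markov inequality, then factorization of the mean of the exponential
    by independence. *)
Lemma sum_tail_le (s : seq nat) (N : nat) (r : R) :
  uniq s -> [set` s] `<=` J -> (size s <= N)%N -> (0 < N)%N -> (0 <= r)%R ->
  P [set w | r <= \sum_(i <- s) g i (X i w)]%R <=
  (expR (- (r ^+ 2 / (32 * N%:R))))%:E.
Proof.
move=> us sJ sN N0 r0.
have NR : (0 < N%:R :> R)%R by rewrite ltr0n.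
(* The minimizer of - l r + 8 l ^ 2 N. *)
pose l : R := (r / (16 * N%:R))%R.
have l0 : (0 <= l)%R by rewrite divr_ge0// mulr_ge0// ltW.
pose f i u := expR (l * g i u).
have mf i : measurable_fun setT (f i).
  by apply: measurableT_comp => //; exact: measurable_funM.
have f0 i u : (0 <= f i u)%R by exact: expR_ge0.
have fle i : J i -> \int[P]_w (f i (X i w))%:E <= (expR (8 * l ^+ 2))%:E.
  move=> Ji; apply: (@integral_expR_le (fun w => g i (X i w))) => //.
  - exact: measurableT_comp.
  - exact: Eg.
pose m i := fine (\int[P]_w (f i (X i w))%:E).
have fm i : J i -> \int[P]_w (f i (X i w))%:E = (m i)%:E.
  move=> Ji; rewrite fineK// ge0_fin_numE.
    exact: le_lt_trans (fle i Ji) (ltry _).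
  by apply: integral_ge0 => w _; rewrite lee_fin.
have mle i : J i -> (m i <= expR (8 * l ^+ 2))%R.
  by move=> Ji; rewrite -lee_fin -fm// fle.
have m0 i : (0 <= m i)%R.
  by apply: fine_ge0; apply: integral_ge0 => w _; rewrite lee_fin.
have mS : measurable_fun setT (fun w => \sum_(i <- s) g i (X i w))%R.
  by apply: measurable_sum => i; exact: measurableT_comp.
set D := [set w | _].
have mD : measurable D.
  rewrite (_ : D = setT `&` (fun w => \sum_(i <- s) g i (X i w))%R @^-1` `[r, +oo[).
    exact: mS.
  by rewrite setTI; apply/seteqP; split=> w /=; rewrite in_itv/= andbT.
have -> : P D = \int[P]_w (\1_D w)%:E by rewrite integral_indic// setIT.
apply: (@le_trans _ _ (\int[P]_w ((expR (- (l * r)))%:E *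
    (\prod_(i <- s) f i (X i w))%:E))).
  apply: ge0_le_integral => //.
  - by apply/measurable_EFinP; exact: measurable_indic.

  - apply/measurable_EFinP; apply: measurable_funM => //.
    by apply: measurable_prod => i _; exact: measurableT_comp.
  move=> w _; rewrite -EFinM lee_fin /f -expR_sum -expRD -mulr_sumr.
  rewrite indicE; case: (boolP (w \in D)) => wD; last exact: expR_ge0.
  have rw : (r <= \sum_(i <- s) g i (X i w))%R by move: wD; rewrite inE.
  by rewrite -expR0 ler_expR addrC -mulrBr mulr_ge0// subr_ge0.
rewrite ge0_integralZl//; last 2 first.
- by apply/measurable_EFinP; apply: measurable_prod => i _; exact: measurableT_comp.
- by move=> w _; rewrite lee_fin prodr_ge0.
rewrite (integral_prod indep mf f0 fm us sJ) -EFinM lee_fin.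
apply: (@le_trans _ _ (expR (- (l * r)) * expR (8 * l ^+ 2 * N%:R)))%R.
  rewrite ler_wpM2l ?expR_ge0//.
  apply: (@le_trans _ _ (\prod_(i <- s) expR (8 * l ^+ 2)))%R.
    rewrite !big_seq; apply: ler_prod => i is_; rewrite m0/=.
    by apply: mle; exact: sJ.
  rewrite big_const_seq count_predT iter_mulr_1 -expRM_natr ler_expR.
  by rewrite ler_wpM2l ?ler_nat// mulr_ge0// sqr_ge0.
rewrite -expRD ler_expR.
suff -> : (- (l * r) + 8 * l ^+ 2 * N%:R = - (r ^+ 2 / (32 * N%:R)))%R by [].
by rewrite /l; field; rewrite gt_eqF.
Qed.

End Concentration.

(** * Means under the uniform law *)

Section Integration.
Context {R : realType}.
Implicit Types (F f : R -> R) (a b t phi : R).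

Lemma integral_is_derive F f a b : a < b ->
  (forall x, a <= x <= b -> is_derive x 1 F (f x)) ->
  (forall x, a <= x <= b -> {for x, continuous f}) ->
  (\int[@lebesgue_measure R]_(x in `[a, b]) (f x)%:E = (F b - F a)%:E)%E.
Proof.
move=> ab dF cf.
have cF x : a <= x <= b -> {for x, continuous F}.
  move=> xab; apply/differentiable_continuous/derivable1_diffP.
  exact: (@ex_derive _ _ _ _ _ _ _ (dF x xab)).
rewrite EFinB; apply: continuous_FTC2 => //.
- apply: continuous_in_subspaceT => x; rewrite inE/= in_itv/= => xab.
  exact: cf.
- split.
  + move=> x; rewrite in_itv/= => /andP[ax xb].
    by apply: ex_derive; apply: dF; rewrite !ltW.
  + by apply: cvg_at_right_filter; apply: cF; rewrite lexx ltW.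
  + by apply: cvg_at_left_filter; apply: cF; rewrite lexx ltW.
- move=> x; rewrite in_itv/= => /andP[ax xb]; rewrite derive1E.
  by apply: derive_val; apply: dF; rewrite !ltW.
Qed.

Lemma continuous_osc t phi u : 0 < u -> {for u, continuous (osc t phi)}.
Proof.
move=> u0; apply/differentiable_continuous/derivable1_diffP.
exact: (@ex_derive _ _ _ _ _ _ _ (is_derive_cos_ln t phi u0)).
Qed.

Lemma measurable_osc t phi : measurable_fun [set: R] (osc t phi).
Proof.
apply: measurableT_comp; first exact: continuous_measurable_fun (@continuous_cos R).
by apply: measurable_funD => //; apply: measurable_funM.
Qed.

(** Change of variables to the uniform law, then the fundamental theorem of calculus; the shift c >=
    1 makes the integrand nonnegative. *)
Lemma integral_osc_uniform (d : measure_display) (T : measurableType d)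
    (P : probability T R) (X : {RV P >-> R}) a b (ab : a < b) t phi (c : R) :
  uniformly_selected X ab -> 0 < a -> 1 <= c ->
  (\int[P]_w (osc t phi (X w) + c)%:E =
   ((osc1 t phi b - osc1 t phi a) / (b - a) + c)%:E)%E.
Proof.
move=> [_ uX] a0 c1.
have mf : measurable_fun [set: R] (fun u : R => (osc t phi u + c)%:E).
  by apply/measurable_EFinP; apply: measurable_funD => //; exact: measurable_osc.
have f0 (u : R) : (0 <= (osc t phi u + c)%:E)%E.
  rewrite lee_fin; have := norm_osc_le t phi u; rewrite ler_norml => /andP[].
  by move: c1; lra.
(* [uniform_prob] lives on [measurableTypeR R], whose display differs from the
   one of the codomain of [X]. *)
have mX : measurable_fun [set: T] (X : T -> measurableTypeR R).
  by move=> mT B mB; exact: (@measurable_funPT _ _ _ _ X mT B mB).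
pose X' : {mfun T >-> measurableTypeR R} :=
  HB.pack (X : T -> measurableTypeR R) (isMeasurableFun.Build _ _ _ _ _ mX).
rewrite -(@ge0_integral_distribution _ _ _ (measurableTypeR R) _ P X' _ mf f0).
transitivity (\int[uniform_prob ab]_y (osc t phi y + c)%:E)%E.
  by apply: eq_measure_integral => B mB _; exact: uX.
rewrite integral_uniform//.
have -> : (\int[@lebesgue_measure R]_(x in `[a, b]) (osc t phi x + c)%:E =
    (osc1 t phi b + c * b - (osc1 t phi a + c * a))%:E)%E; last first.
  rewrite -EFinM; congr EFin; field.
  by rewrite gt_eqF// subr_gt0.
apply: (@integral_is_derive (fun u => osc1 t phi u + c * u)) => //.
- move=> x /andP[ax _]; have x0 : 0 < x by exact: lt_le_trans ax.
  have dx := is_derive_osc1 t phi x0.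
  by apply: is_derive_eq; rewrite /GRing.scale/= mulr1.
- move=> x /andP[ax _]; have x0 : 0 < x by exact: lt_le_trans ax.
  by apply: continuousD; [exact: continuous_osc|exact: cvg_cst].
Qed.

End Integration.

(** * Tails of the centred sums *)

Section Deviations.
Context {R : realType} {d : measure_display} {T : measurableType d}.
Variable P : probability T R.
Variables A K theta : R.
Hypotheses (A0 : 0 < A) (K0 : 0 < K) (theta0 : 0 < theta) (theta1 : theta < 1).
Variable n : nat -> {RV P >-> R}.
Hypothesis n_unif : forall (j : nat) (jgt0 : (0 < j)%N),
  uniformly_selected (n j) (sel_lt theta A0 K0 jgt0).
Hypothesis n_indep : mutually_independent [set j : nat | (0 < j)%N] n.
Variable j0 : nat.
Hypothesis j01 : (1 < j0)%N.
Hypothesis j0P :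
  forall y : R, j0%:R <= y -> K * y `^ theta <= y / (2 * A) /\ 2 * A <= y.
Implicit Types (t phi r : R) (w : T) (N m : nat).

Let mean t phi (j : nat) := secant A K theta (osc1 t phi) j%:R.

(** The sum starts at [j0], since a smaller window may be truncated at 0, and its mean is then not
    the secant slope. *)
Definition deviation N t phi w : R :=
  \sum_(j0 <= j < N.+1) (osc t phi (n j w) - mean t phi j).

Lemma sel_lo_large (j : nat) : (j0 <= j)%N -> sel_lo A K theta j = lo A K theta j%:R.
Proof.
move=> j0j; apply/max_idPr; apply: le_trans (lo_ge1 A0 j0P _) => //.
by rewrite ler_nat.
Qed.

Lemma integral_osc_mean t phi (j : nat) : (j0 <= j)%N ->
  (\int[P]_w (osc t phi (n j w) - mean t phi j + 2)%:E = 2%:E)%E.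
Proof.
move=> j0j; have jgt0 : (0 < j)%N by apply: leq_trans j0j; exact: ltnW.
have jj : (j0%:R : R) <= j%:R by rewrite ler_nat.
have l1 := lo_ge1 A0 j0P jj.
have M1 := norm_secant_osc1_le A0 K0 j01 j0P t phi jj.
(* The shift becomes 2 minus the mean, which is at least 1. *)
under eq_integral do rewrite -addrA.
rewrite (@integral_osc_uniform _ _ _ P _ _ _ _ t phi _ (n_unif jgt0)).
- rewrite sel_lo_large// /mean /secant.
  have -> : sel_hi A K theta j - lo A K theta j%:R = 2 * K * j%:R `^ theta.
    by rewrite /sel_hi /lo; ring.
  rewrite -[sel_hi A K theta j]/(hi A K theta j%:R).
  by congr EFin; rewrite addrA subrr add0r.
- by rewrite sel_lo_large//; exact: lt_le_trans l1.
- by move: M1; rewrite ler_norml -/(mean t phi j) => /andP[_]; lra.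
Qed.

Lemma deviation_tail_le N t phi r : (0 < N)%N -> 0 <= r ->
  (P [set w | r <= deviation N t phi w]%R <= (expR (- (r ^+ 2 / (32 * N%:R))))%:E)%E.
Proof.
move=> N0 r0.
(* For j < j0 the mean need not be bounded by 1. *)
pose g (j : nat) (u : R) := osc t phi u -
  (if (j0 <= j)%N then mean t phi j else 0).
have := @sum_tail_le R d T P [set j | (j0 <= j)%N] n _ g _ _ _
  (index_iota j0 N.+1) N r (iota_uniq _ _).
have -> : [set w | r <= \sum_(i <- index_iota j0 N.+1) g i (n i w)] =
  [set w | r <= deviation N t phi w].
  apply/seteqP; split=> w /=; rewrite /deviation;
  suff -> : \sum_(i <- index_iota j0 N.+1) g i (n i w) =
    \sum_(j0 <= j < N.+1) (osc t phi (n j w) - mean t phi j) by [];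
  by apply: eq_big_nat => j /andP[j0j _]; rewrite /g j0j.
apply=> //.
- move=> F B FJ mB; apply: n_indep => // j /FJ /=.
  by apply: leq_trans; exact: ltnW.
- by move=> j; apply: measurable_funB => //; exact: measurable_osc.
- move=> j u; apply: (le_trans (ler_normB _ _)).
  have -> : 2 = 1 + 1 :> R by lra.
  apply: lerD; first exact: norm_osc_le.
  case: ifPn => j0j; last by rewrite normr0.
  by apply: (norm_secant_osc1_le A0 K0 j01 j0P); rewrite ler_nat.
- by move=> j /= j0j; rewrite /g j0j; exact: integral_osc_mean.
- by move=> j /=; rewrite mem_index_iota => /andP[].
- by rewrite size_iota leq_subLR -add1n leq_add2r ltnW.
Qed.

End Deviations.

(** * Elementary inequalities *)

Section Numeric.
Context {R : realType}.

Lemma sqrtr_add_le (a b : R) : 0 <= a -> 0 <= b ->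
  Num.sqrt (a + b) <= Num.sqrt a + Num.sqrt b.
Proof.
move=> a0 b0; rewrite -[leRHS]ger0_norm ?addr_ge0 ?sqrtr_ge0// -sqrtr_sqr.
by rewrite ler_wsqrtr// sqrrD !sqr_sqrtr// addrAC lerDl mulrn_wge0.
Qed.

Lemma ln_le_sqrt (x : R) : 0 < x -> ln x <= 2 * Num.sqrt x.
Proof.
move=> x0; have s0 : 0 < Num.sqrt x by rewrite sqrtr_gt0.
have -> : ln x = 2 * ln (Num.sqrt x).
  by rewrite mulr_natl -lnXn// sqr_sqrtr// ltW.
by rewrite ler_pM2l// ltW// ln_sublinear.
Qed.

Lemma nneseries_inv_sqr_le (u : nat -> \bar R) (c : R) : 0 <= c ->
  (forall k, 0 <= u k)%E -> (forall k, u k <= (c * (k.+1%:R) ^- 2)%:E)%E ->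
  (\sum_(k <oo) u k <= (2 * c)%:E)%E.
Proof.
move=> c0 u0 uc.
apply: lime_le; first by apply: is_cvg_nneseries => k _ _.
apply: nearW => m.
apply: (@le_trans _ _ (\sum_(0 <= k < m) (c * (k.+1%:R) ^- 2)%:E)%E).
  by apply: lee_sum => k _.
rewrite sumEFin lee_fin -mulr_sumr mulrC ler_wpM2r//.
(* Telescoping majorant: 1 / x ^ 2 <= 2 / x - 2 / (x + 1) for x >= 1. *)
apply: (@le_trans _ _ (\sum_(0 <= k < m) (- 2 / k.+2%:R - (- 2 / k.+1%:R)))).
  apply: ler_sum => k _.
  have k1 : (0 : R) < k.+1%:R by [].
  have -> : k.+2%:R = k.+1%:R + 1 :> R by rewrite natr1.
  have k10 : 1 <= k.+1%:R :> R by rewrite ler1n.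
  set x : R := k.+1%:R in k1 k10 *.
  have -> : - 2 / (x + 1) - (- 2 / x) = 2 * x / (x + 1) * x ^- 2.
    by field; rewrite !gt_eqF//; lra.
  rewrite ler_peMl ?invr_ge0 ?sqr_ge0// ler_pdivlMr; lra.
rewrite (telescope_sumr (fun k => - 2 / k.+1%:R))// divr1 opprK.
by rewrite mulNr addrC gerBl divr_ge0.
Qed.

End Numeric.

(** * Almost sure bound for the centred sums, uniform in t *)

Section AlmostSure.
Context {R : realType} {d : measure_display} {T : measurableType d}.
Variable P : probability T R.
Variables A K theta : R.
Hypotheses (A0 : 0 < A) (K0 : 0 < K) (theta0 : 0 < theta) (theta1 : theta < 1).
Variable n : nat -> {RV P >-> R}.
Hypothesis n_unif : forall (j : nat) (jgt0 : (0 < j)%N),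
  uniformly_selected (n j) (sel_lt theta A0 K0 jgt0).
Hypothesis n_indep : mutually_independent [set j : nat | (0 < j)%N] n.
Variable j0 : nat.
Hypothesis j01 : (1 < j0)%N.
Hypothesis j0P :
  forall y : R, j0%:R <= y -> K * y `^ theta <= y / (2 * A) /\ 2 * A <= y.
Implicit Types (t phi r : R) (w : T) (N m : nat).

Local Notation dev := (deviation A K theta n j0).

(** A phase shift by pi changes the sign, so that the upper tail bound also yields the lower one. *)
Lemma deviationN N t phi w : - dev N t phi w = dev N t (phi + pi) w.
Proof.
rewrite /deviation -sumrN; apply: eq_bigr => j _.
have o1 u : osc1 t (phi + pi) u = - osc1 t phi u.
  by rewrite /osc1 addrA cosDpi sinDpi mulrN -opprD mulrN mulNr.
have o u : osc t (phi + pi) u = - osc t phi u by rewrite /osc addrA cosDpi.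
by rewrite o /secant !o1; ring.
Qed.

Lemma measurable_deviation N t phi : measurable_fun setT (dev N t phi).
Proof.
apply: measurable_sum => j; apply: measurable_funB => //.
by apply: measurableT_comp => //; exact: measurable_osc.
Qed.

Lemma norm_deviation_le N t phi w : `|dev N t phi w| <= 2 * N%:R.
Proof.
apply: (le_trans (ler_norm_sum _ _ _)).
apply: (@le_trans _ _ (\sum_(j0 <= j < N.+1) (2 : R))).
  apply: ler_sum_nat => j /andP[j0j _]; apply: (le_trans (ler_normB _ _)).
  have -> : 2 = 1 + 1 :> R by lra.
  apply: lerD; first exact: norm_osc_le.
  by apply: (norm_secant_osc1_le A0 K0 j01 j0P); rewrite ler_nat.
rewrite sumr_const_nat -[leLHS]mulr_natr ler_wpM2l// ler_nat.
by rewrite leq_subLR -add1n leq_add2r ltnW.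
Qed.

Lemma dist_osc_le t t' phi u : 1 <= u ->
  `|osc t phi u - osc t' phi u| <= `|t - t'| * ln u.
Proof.
move=> u1; apply: (le_trans (dist_cos_le _ _)).
rewrite opprD addrACA subrr addr0 -mulrBl normrM.
by rewrite (ger0_norm (ln_ge0 u1)).
Qed.

(** All the windows involved lie in [1, 2 N / A], where the logarithm is at most ln N + |ln (2 /
    A)|; this is a Lipschitz constant in t for each value of [osc], hence also for each mean. *)
Lemma dist_deviation_le N t t' phi w : (0 < N)%N ->
  `|dev N t phi w - dev N t' phi w|
  <= 2 * N%:R * (`|t - t'| * (ln N%:R + `|ln (2 / A)|)).
Proof.
move=> N0; rewrite /deviation -sumrB.
set b := `|t - t'| * _.
have b0 : 0 <= b.
  by rewrite mulr_ge0// addr_ge0// ln_ge0// ler1n.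
apply: (le_trans (ler_norm_sum _ _ _)).
apply: (@le_trans _ _ (\sum_(j0 <= j < N.+1) (2 * b))); last first.
  rewrite sumr_const_nat -[leLHS]mulr_natr mulrAC ler_wpM2r// ler_wpM2l// ler_nat.
  by rewrite leq_subLR -add1n leq_add2r ltnW.
apply: ler_sum_nat => j /andP[j0j jN].
have jj : (j0%:R : R) <= j%:R by rewrite ler_nat.
have l1 := lo_ge1 A0 j0P jj.
have jgt0 : (0 < j)%N by apply: leq_trans j0j; exact: ltnW.
have jR : (0 : R) < j%:R by rewrite ltr0n.
have hiN : hi A K theta j%:R <= N%:R * (2 / A).
  have [kj _] := j0P jj; rewrite /hi.
  apply: (@le_trans _ _ (j%:R * (2 / A))); last first.
    by rewrite ler_wpM2r ?divr_ge0 ?(ltW A0)// ler_nat -ltnS.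
  have -> : j%:R * (2 / A) = 4 * (j%:R / (2 * A)) by field; rewrite gt_eqF.
  have -> : j%:R / A = 2 * (j%:R / (2 * A)) by field; rewrite gt_eqF.
  have : 0 < j%:R / (2 * A) by rewrite divr_gt0 ?mulr_gt0.
  by lra.
have D (u : R) : lo A K theta j%:R <= u -> u <= hi A K theta j%:R ->
    `|osc t phi u - osc t' phi u| <= b.
  move=> lu uh; have u1 := le_trans l1 lu.
  apply: (le_trans (dist_osc_le _ _ _ u1)); rewrite ler_wpM2l//.
  have N1 : (0 : R) < N%:R by rewrite ltr0n.
  have A2 : 0 < 2 / A by rewrite divr_gt0.
  apply: (@le_trans _ _ (ln (N%:R * (2 / A)))).
    rewrite ler_ln ?posrE//; first exact: le_trans hiN.
      exact: lt_le_trans u1.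
    by rewrite mulr_gt0.
  by rewrite lnM ?posrE// lerD2l ler_norm.
have -> : osc t phi (n j w) - secant A K theta (osc1 t phi) j%:R -
    (osc t' phi (n j w) - secant A K theta (osc1 t' phi) j%:R) =
  (osc t phi (n j w) - osc t' phi (n j w)) -
  (secant A K theta (osc1 t phi) j%:R - secant A K theta (osc1 t' phi) j%:R).
  by ring.
apply: (le_trans (ler_normB _ _)).
have -> : 2 * b = b + b by ring.
apply: lerD.
  have [+ _] := n_unif jgt0; move=> /(_ w); rewrite /= in_itv/=.
  rewrite (sel_lo_large A0 j0P j0j) => /andP[nl nh].
  by apply: D; [exact: ltW|exact: nh].
(* By linearity and the mean value theorem, the difference of the means is a difference of values of
   [osc] at one point of the window. *)
have -> : secant A K theta (osc1 t phi) j%:R - secant A K theta (osc1 t' phi) j%:R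
    = secant A K theta (fun u => osc1 t phi u - osc1 t' phi u) j%:R.
  by rewrite /secant; ring.
have [|u u0|c /andP[lc ch] ->] := @secant_mean R A K theta K0
    (fun u => osc1 t phi u - osc1 t' phi u)
    (fun u => osc t phi u - osc t' phi u) j%:R jR.
- exact: lt_le_trans l1.
- have d1 := is_derive_osc1 t phi u0; have d2 := is_derive_osc1 t' phi u0.
  exact: is_deriveB.
- exact: D.
Qed.

(** With the factor 8, the tail exponent [level] ^ 2 / (32 N) equals 2 ln (N + 1) + 2 ln (m + 1). *)
Let level N m : R := 8 * Num.sqrt (N%:R * (ln N.+1%:R + ln m.+1%:R)).

(** The grid point is t = s m / N; taking s = 1 and s = - 1 covers both signs of t. *)
Let bad (s : R) phi N m : set T :=
  [set w | level N m <= `|dev N (s * (m%:R / N%:R)) phi w|].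

Let ln_nat_ge0 (k : nat) : (0 : R) <= ln k.+1%:R.
Proof. by rewrite ln_ge0// ler1n. Qed.

Let measurable_bad s phi N m : measurable (bad s phi N m).
Proof.
have mD : measurable_fun setT (fun w => `|dev N (s * (m%:R / N%:R)) phi w|).
  by apply: measurableT_comp => //; exact: measurable_deviation.
rewrite (_ : bad s phi N m =
  setT `&` (fun w => `|dev N (s * (m%:R / N%:R)) phi w|) @^-1` `[level N m, +oo[).
  exact: mD.
by rewrite setTI; apply/seteqP; split=> w /=; rewrite in_itv/= andbT.
Qed.

Let bad_le s phi N m : (0 < N)%N ->
  (P (bad s phi N m) <= (2 * N.+1%:R ^- 2 * m.+1%:R ^- 2)%:E)%E.
Proof.
move=> N0; set t := s * (m%:R / N%:R); set r := level N m.
have r0 : 0 <= r by rewrite mulr_ge0 ?sqrtr_ge0.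
have NR : (0 : R) < N%:R by rewrite ltr0n.
have L0 : 0 <= ln N.+1%:R + ln m.+1%:R :> R by rewrite addr_ge0.
have E : expR (- (r ^+ 2 / (32 * N%:R))) = N.+1%:R ^- 2 * m.+1%:R ^- 2.
  have -> : r ^+ 2 / (32 * N%:R) = 2 * ln N.+1%:R + 2 * ln m.+1%:R.
    rewrite /r /level exprMn sqr_sqrtr; last by rewrite mulr_ge0// ltW.
    by field; rewrite gt_eqF.
  rewrite opprD expRD !expRN !mulr_natl.
  by rewrite -!lnXn ?ltr0n// !lnK ?posrE ?exprn_gt0.
have T1 := deviation_tail_le n_unif n_indep j01 j0P t phi N0 r0.
have T2 := deviation_tail_le n_unif n_indep j01 j0P t (phi + pi) N0 r0.
have m1 p : measurable [set w | r <= dev N t p w].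
  rewrite (_ : [set w | _] = setT `&` (dev N t p) @^-1` `[r, +oo[).
    exact: measurable_deviation.
  by rewrite setTI; apply/seteqP; split=> w /=; rewrite in_itv/= andbT.
apply: (@le_trans _ _ (P ([set w | r <= dev N t phi w] `|`
    [set w | r <= dev N t (phi + pi) w]))).
  apply: le_measure; rewrite ?inE//.
  - exact: measurableU.
  - move=> w /=; rewrite -deviationN -/t -/r.
    by rewrite /bad/= -/t -/r ler_normr => /orP[]; [left|right].
apply: (le_trans (measureU2 _ _ _)) => //.
have -> : 2 * N.+1%:R ^- 2 * m.+1%:R ^- 2 = expR (- (r ^+ 2 / (32 * N%:R))) +
  expR (- (r ^+ 2 / (32 * N%:R))) by rewrite E; ring.
by rewrite EFinD leeD.
Qed.

(** Borel-Cantelli for the events [E k], which join all grid points for N = k + 1 and have summable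
    probabilities. *)
Let ae_not_bad (s : R) phi : {ae P, forall w, exists k0 : nat, forall N m,
  (k0 < N)%N -> `|dev N (s * (m%:R / N%:R)) phi w| <= level N m}.
Proof.
pose E k := \bigcup_m bad s phi k.+1 m.
have mE k : measurable (E k) by apply: bigcup_measurable => m _.
have PE k : (P (E k) <= (4 * k.+1%:R ^- 2)%:E)%E.
  apply: (@le_trans _ _ (\sum_(m <oo) P (bad s phi k.+1 m))%E).
    by apply: measure_sigma_subadditive.
  have -> : 4 * k.+1%:R ^- 2 = 2 * (2 * k.+1%:R ^- 2) :> R by ring.
  apply: nneseries_inv_sqr_le => [|//|m]; first by rewrite mulr_ge0 ?invr_ge0 ?sqr_ge0.
  apply: (le_trans (bad_le _ _ _ _)) => //.
  rewrite lee_fin ler_wpM2r ?invr_ge0 ?sqr_ge0// ler_wpM2l//.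
  by rewrite lef_pV2 ?posrE ?exprn_gt0// ler_sqr ?nnegrE// ler_nat.
exists (lim_sup_set E); split.
- apply: bigcap_measurableType => k _; apply: bigcup_measurable => i _; exact: mE.
- apply: lim_sup_set_cvg0 => //.
  apply: (@le_lt_trans _ _ (2 * 4)%:E); last exact: ltry.
  exact: nneseries_inv_sqr_le.
- move=> w /= nw k _; apply: contrapT => nk; apply: nw; exists k => N m kN.
  have N0 : (0 < N)%N by exact: leq_trans kN.
  rewrite leNgt; apply/negP => h; apply: nk; exists N.-1; first by rewrite /= -ltnS prednK.
  by exists m => //; rewrite /bad/= prednK// ltW.
Qed.

Let ae_deviation_sgn (s : R) phi : `|s| <= 1 -> {ae P, forall w, exists C : R,
  forall N t, (0 < N)%N -> 0 <= t ->
  `|dev N (s * t) phi w|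
  <= C * (Num.sqrt N%:R * (Num.sqrt (ln N.+1%:R) + Num.sqrt (ln (t + 1))))}.
Proof.
move=> s1; apply: filterS (ae_not_bad s phi) => w [k0 kP].
pose c0 : R := Num.sqrt (ln 2).
have c00 : 0 < c0 by rewrite sqrtr_gt0 ln_gt0// ltr1n.
pose B : R := `|ln (2 / A)|.
have B0 : 0 <= B by exact: normr_ge0.
(* The three terms come from the trivial bound 2 N for N <= [k0], from the level at the grid point,
   and from the distance of t to the grid. Division by [c0] is paid for by [c0] <= sqrt (ln (N +
   1)). *)
exists (2 * k0%:R / c0 + 16 + (4 + 2 * B) / c0) => N t N0 t0.
have NR : (0 : R) < N%:R by rewrite ltr0n.
have N1 : (1 : R) <= N%:R by rewrite ler1n.
have sN1 : 1 <= Num.sqrt N%:R :> R by rewrite -[leLHS]sqrtr1 ler_wsqrtr.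
have cN : c0 <= Num.sqrt (ln N.+1%:R).
  by rewrite ler_wsqrtr// ler_ln ?posrE ?ltr0n// ler_nat.
have lt0 : 0 <= Num.sqrt (ln (t + 1)) by exact: sqrtr_ge0.
set sN := Num.sqrt N%:R in sN1 *; set sl := Num.sqrt (ln N.+1%:R) in cN *.
set st := Num.sqrt (ln (t + 1)) in lt0 *.
have a1 : 0 <= 2 * k0%:R / c0 by rewrite divr_ge0 ?mulr_ge0// ltW.
have a2 : 0 <= (4 + 2 * B) / c0 by rewrite divr_ge0 ?addr_ge0 ?mulr_ge0// ltW.
have sN0 : 0 <= sN by lra.
have sl0 : 0 <= sl by lra.
have p0 : 0 <= sN * (sl + st) by rewrite mulr_ge0// addr_ge0.
have pc : c0 * sN <= sN * (sl + st) by nra.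
have [Nk|kN] := leqP N k0.
  apply: (le_trans (norm_deviation_le _ _ _ _)).
  apply: (@le_trans _ _ (2 * k0%:R / c0 * (sN * (sl + st)))).
    apply: (@le_trans _ _ (2 * k0%:R / c0 * c0)).
      by rewrite divfK ?gt_eqF// ler_wpM2l// ler_nat.
    by rewrite ler_wpM2l//; nra.
  by rewrite ler_wpM2r//; lra.
pose m := Num.truncn (t * N%:R).
have tN0 : 0 <= t * N%:R by rewrite mulr_ge0// ltW.
have mt : m%:R <= t * N%:R by rewrite truncn_le.
have tm : t * N%:R < m%:R + 1 by rewrite natr1 truncnS_gt.
have Dt : `|s * t - s * (m%:R / N%:R)| <= N%:R^-1.
  rewrite -mulrBr normrM; apply: (@le_trans _ _ (1 * `|t - m%:R / N%:R|)).
    by rewrite ler_wpM2r.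
  rewrite mul1r ger0_norm; last by rewrite subr_ge0 ler_pdivrMr.
  by rewrite lerBlDr -{1}[N%:R^-1]mul1r -mulrDl ler_pdivlMr// addrC ltW.
have D1 : `|dev N (s * t) phi w - dev N (s * (m%:R / N%:R)) phi w|
    <= (4 + 2 * B) * sN.
  apply: (le_trans (dist_deviation_le _ _ _ _ N0)).
  apply: (@le_trans _ _ (2 * N%:R * (N%:R^-1 * (ln N%:R + B)))).
    rewrite ler_wpM2l ?mulr_ge0 ?(ltW NR)// ler_wpM2r// addr_ge0// ln_ge0//.
  rewrite mulrA -[2 * _ * _]mulrA mulfV ?gt_eqF// mulr1.
  by have := ln_le_sqrt NR; rewrite -/sN; nra.
have D2 := kP N m kN.
have D3 : level N m <= 16 * (sN * (sl + st)).
  rewrite /level sqrtrM ?(ltW NR)// -/sN.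
  (* Since m <= t N, one has m + 1 <= (N + 1) (t + 1). *)
  have h1 : Num.sqrt (ln N.+1%:R + ln m.+1%:R) <= sl + sl + st.
    apply: (le_trans (sqrtr_add_le _ _)) => //.
    rewrite -addrA lerD2l.
    have t1 : 0 <= ln (t + 1) by rewrite ln_ge0// lerDr.
    apply: (le_trans _ (sqrtr_add_le _ _)) => //.
    rewrite ler_wsqrtr// -lnM ?posrE ?ltr0n//; last by lra.
    rewrite ler_ln ?posrE ?ltr0n ?mulr_gt0 ?ltr0n//; last by lra.
    rewrite -!natr1; nra.
  by nra.
have D4 : (4 + 2 * B) * sN <= (4 + 2 * B) / c0 * (sN * (sl + st)).
  by rewrite -mulrA ler_wpM2l ?addr_ge0 ?mulr_ge0// ler_pdivlMl.
have -> : dev N (s * t) phi w =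
  (dev N (s * t) phi w - dev N (s * (m%:R / N%:R)) phi w) +
  dev N (s * (m%:R / N%:R)) phi w by ring.
apply: (le_trans (ler_normD _ _)).
by nra.
Qed.

Lemma ae_deviation_le phi : {ae P, forall w, exists C : R,
  forall N t, (0 < N)%N -> `|dev N t phi w|
  <= C * (Num.sqrt N%:R * (Num.sqrt (ln N.+1%:R) + Num.sqrt (ln (`|t| + 1))))}.
Proof.
have h1 := @ae_deviation_sgn 1 phi; have h2 := @ae_deviation_sgn (-1) phi.
apply: filterS2 (h1 _) (h2 _); rewrite ?normrN ?normr1// => w [C1 P1] [C2 P2].
exists (Num.max C1 C2) => N t N0.
have q0 : 0 <= Num.sqrt N%:R * (Num.sqrt (ln N.+1%:R) + Num.sqrt (ln (`|t| + 1))).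
  by rewrite mulr_ge0 ?addr_ge0 ?sqrtr_ge0.
have [t0|t0] := leP 0 t.
  have := P1 N `|t| N0 (normr_ge0 _); rewrite mul1r {1}(ger0_norm t0) => /le_trans; apply.
  by rewrite ler_wpM2r// le_max lexx.
have := P2 N `|t| N0 (normr_ge0 _); rewrite mulN1r {1}(ltr0_norm t0) opprK.
by move=> /le_trans; apply; rewrite ler_wpM2r// le_max lexx orbT.
Qed.

End AlmostSure.

(** * Power sums and integrals in real and imaginary parts *)

Section PowerSumParts.
Context {R : realType}.
Implicit Types (s : nat -> R) (t x : R) (m : nat).

Lemma Re_power_sum s x t m :
  (forall j, (0 < j)%N -> s j <= x -> (j < m)%N) ->
  complex.Re (power_sum s x t) = \sum_(j \in indices_le s x) osc t 0 (s j).
Proof.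
move=> sm; rewrite /power_sum !(sum_indices_le _ sm) (raddf_sum (@complex.Re R)).
by apply: eq_bigr => j _; exact: Re_cpowR.
Qed.

Lemma Im_power_sum s x t m :
  (forall j, (0 < j)%N -> s j <= x -> (j < m)%N) ->
  complex.Im (power_sum s x t) = \sum_(j \in indices_le s x) osc t (pi / 2) (s j).
Proof.
move=> sm; rewrite /power_sum !(sum_indices_le _ sm) (raddf_sum (@complex.Im R)).
by apply: eq_bigr => j _; exact: Im_cpowR.
Qed.

Lemma Rintegral_osc (A a b t phi : R) : 0 < a -> a <= b ->
  Rintegral (@lebesgue_measure R) `[a, b] (fun u => osc t phi u * A)
  = A * osc1 t phi b - A * osc1 t phi a.
Proof.
move=> a0; rewrite le_eqVlt => /predU1P[<-|ab].
  by rewrite subrr set_itv1 Rintegral_set1.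
have -> : A * osc1 t phi b - A * osc1 t phi a =
  fine (A * osc1 t phi b - A * osc1 t phi a)%:E by [].
congr fine.
apply: (@integral_is_derive _ (fun u => A * osc1 t phi u)) => //.
- move=> u /andP[au _]; have u0 : 0 < u by exact: lt_le_trans au.
  have du := is_derive_osc1 t phi u0.
  by rewrite mulrC; exact: is_deriveZ.
- move=> u /andP[au _]; have u0 : 0 < u by exact: lt_le_trans au.
  by apply: continuousM; [exact: continuous_osc|exact: cvg_cst].
Qed.

Lemma Cintegral_cpowR (A a b t : R) : 0 < a -> a <= b ->
  Cintegral a b (fun u => cpowR u (0 -i* t) * (derive1 (fun x => A * x) u)%:C)
  = (A * osc1 t 0 b - A * osc1 t 0 a)
    +i* (A * osc1 t (pi / 2) b - A * osc1 t (pi / 2) a).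
Proof.
move=> a0 ab.
have dA u : derive1 (fun x : R => A * x) u = A.
  by rewrite derive1E deriveZ//= derive_id [LHS]mulr1.
rewrite /Cintegral -!Rintegral_osc//; congr (_ +i* _); congr (Rintegral _ _ _);
  apply/funext => u; rewrite dA.
- by rewrite -Re_cpowR; case: (cpowR _ _) => p q /=; rewrite mulr0 subr0.
- by rewrite -Im_cpowR; case: (cpowR _ _) => p q /=; rewrite mulr0 add0r.
Qed.

End PowerSumParts.

(** * Combination of the estimates *)

Section Assembly.
Context {R : realType} {d : measure_display} {T : measurableType d}.
Variable P : probability T R.
Variables A K theta : R.
Hypotheses (A0 : 0 < A) (K0 : 0 < K) (theta0 : 0 < theta) (theta1 : theta < 1).
Variable n : nat -> {RV P >-> R}.
Hypothesis n_unif : forall (j : nat) (jgt0 : (0 < j)%N),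
  uniformly_selected (n j) (sel_lt theta A0 K0 jgt0).
Hypothesis n_indep : mutually_independent [set j : nat | (0 < j)%N] n.
Implicit Types (t x phi : R) (w : T) (s : nat -> R).

Lemma in_windows_selected w : in_windows A K theta (fun j => n j w).
Proof. by move=> j j0; have [/(_ w)] := n_unif j0; rewrite /= in_itv. Qed.

Definition error x t : R :=
  Num.sqrt x * (Num.sqrt (ln (x + 1)) + Num.sqrt (ln (`|t| + 1)))
  + x `^ theta + x `^ (1 - theta).

Lemma ae_sum_osc phi : {ae P, forall w, exists C : R, forall x t, 1 <= x ->
  `|\sum_(j \in indices_le (fun j => n j w) x) osc t phi (n j w)
    - A * osc1 t phi x| <= C * error x t}.
Proof.
have [j0 j01 j0P] := powR_theta_small A0 K0 theta1.
have [C1 C1P] := sum_indices_near A0 K0 theta0 theta1.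
have [C2 C2P] := sum_secant_at A0 K0 theta0 theta1 j01 j0P.
apply: filterS (ae_deviation_le n_unif n_indep j01 j0P phi) => w [C3 C3P].
pose c0 : R := Num.sqrt (ln 2).
have c00 : 0 < c0 by rewrite sqrtr_gt0 ln_gt0// ltr1n.
(* Chosen so that sqrt (ln (J + 1)) <= [D] sqrt (ln (x + 1)) for J <= A x: here J + 1 <= (A + 1) (x
   + 1), and [c0] <= sqrt (ln (x + 1)) because x >= 1. *)
pose D : R := Num.sqrt (ln (A + 1)) / c0 + 1.
have D1 : 1 <= D by rewrite lerDr divr_ge0 ?sqrtr_ge0// ltW.
exists (`|C1| + j0%:R + `|C3| * (Num.sqrt A * D) + `|C2|) => x t x1.
have x0 : 0 < x by exact: lt_le_trans x1.
have Ax : 0 < A * x by rewrite mulr_gt0.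
have [m _ /(_ (fun j => osc t phi (n j w)))] := C1P _ (in_windows_selected w) x x1.
move=> /(_ (fun j _ => norm_osc_le t phi (n j w))).
set J := Num.truncn (A * x) => h1.
have h2 := C2P t phi x x1; rewrite -/J in h2.
set S := \sum_(j \in _) _ in h1 *.
set S1 := \sum_(1 <= j < J.+1) _ in h1.
pose S2 := \sum_(j0 <= j < J.+1) osc t phi (n j w).
set M := \sum_(j0 <= j < J.+1) _ in h2.
have h3 : `|S1 - S2| <= j0%:R.
  have sumb (a b : nat) : (1 <= a)%N ->
      `|\sum_(a <= j < b) osc t phi (n j w)| <= (b - 1)%:R.
    move=> a1; apply: (le_trans (ler_norm_sum _ _ _)).
    apply: (@le_trans _ _ (\sum_(a <= j < b) (1 : R))).
      by apply: ler_sum => j _; exact: norm_osc_le.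
    by rewrite sumr_const_nat ler_nat leq_sub2l.
  have [jJ|Jj] := leqP j0 J.+1.
    rewrite /S1 /S2 (big_cat_nat _ jJ)/= ?(ltnW j01)// addrK.
    apply: (le_trans (sumb _ _ _)) => //.
    by rewrite ler_nat leq_subr.
  rewrite /S2 [X in _ - X]big_geq ?(ltnW Jj)// subr0.
  apply: (le_trans (sumb _ _ _)) => //.
  by rewrite ler_nat subn1 /= -ltnS ltnW// ltnS ltnW.
have h4 : `|S2 - M| <=
    `|C3| * (Num.sqrt A * D) *
    (Num.sqrt x * (Num.sqrt (ln (x + 1)) + Num.sqrt (ln (`|t| + 1)))).
  have r0 : 0 <= Num.sqrt x * (Num.sqrt (ln (x + 1)) + Num.sqrt (ln (`|t| + 1))).
    by rewrite mulr_ge0 ?addr_ge0 ?sqrtr_ge0.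
  have [J0|J0] := posnP J.
    rewrite /S2 /M J0 !big_geq ?(ltnW j01)// subrr normr0.
    by rewrite mulr_ge0// !mulr_ge0 ?sqrtr_ge0// (le_trans _ D1).
  rewrite /S2 /M -sumrB -/(deviation A K theta n j0 J t phi w).
  apply: (le_trans (C3P J t J0)).
  have JA : J%:R <= A * x by rewrite truncn_le ltW.
  have q1 : Num.sqrt J%:R <= Num.sqrt A * Num.sqrt x.
    by rewrite -sqrtrM ?(ltW A0)// ler_wsqrtr.
  have lx : 0 <= ln (x + 1) by rewrite ln_ge0//; lra.
  have cx : c0 <= Num.sqrt (ln (x + 1)).
    by rewrite ler_wsqrtr// ler_ln ?posrE//; lra.
  have q2 : Num.sqrt (ln J.+1%:R) <= D * Num.sqrt (ln (x + 1)).
    apply: (@le_trans _ _ (Num.sqrt (ln (A + 1) + ln (x + 1)))).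
      have A1 : 0 < A + 1 by rewrite addr_gt0.
      have xp : 0 < x + 1 by lra.
      rewrite ler_wsqrtr// -lnM ?posrE// ler_ln ?posrE ?ltr0n ?mulr_gt0//.
      by rewrite -natr1; nra.
    apply: (le_trans (sqrtr_add_le _ _)) => //.
      by rewrite ln_ge0// lerDr ltW.
    rewrite /D mulrDl mul1r lerD2r -mulrA ler_peMr ?sqrtr_ge0//.
    by rewrite ler_pdivlMl// mulr1.
  apply: (@le_trans _ _ (`|C3| * (Num.sqrt J%:R *
     (Num.sqrt (ln J.+1%:R) + Num.sqrt (ln (`|t| + 1)))))).
    by rewrite ler_wpM2r ?ler_norm// mulr_ge0 ?addr_ge0 ?sqrtr_ge0.
  rewrite -!mulrA ler_wpM2l//.
  set st := Num.sqrt (ln (`|t| + 1)).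
  have st0 : 0 <= st by rewrite sqrtr_ge0.
  apply: (@le_trans _ _ (Num.sqrt A * Num.sqrt x * (D * (Num.sqrt (ln (x + 1)) + st)))).
    apply: ler_pM => //; rewrite ?addr_ge0 ?sqrtr_ge0//.
    by rewrite mulrDr lerD// ler_peMl.
  by rewrite le_eqVlt; apply/orP; left; apply/eqP; ring.
(* In turn: the change of index set, the terms below [j0], the random deviation, and the error in
   the sum of the means. *)
have -> : S - A * osc1 t phi x = (S - S1) + (S1 - S2) + (S2 - M) +
   (M - A * osc1 t phi x) by ring.
have e0 : 0 <= Num.sqrt x * (Num.sqrt (ln (x + 1)) + Num.sqrt (ln (`|t| + 1))).
  by rewrite mulr_ge0 ?addr_ge0 ?sqrtr_ge0.
rewrite /error; set r := Num.sqrt x * _ in h4 e0 *.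
set p := x `^ theta in h1 h2 *; set q := x `^ (1 - theta) in h2 *.
have p1 : 1 <= p by rewrite -[leLHS](powRr0 x) ler_powR// ltW.
have q0 : 0 <= q by exact: powR_ge0.
apply: (le_trans (ler_normD _ _)); rewrite [leRHS]mulrDl; apply: lerD; last first.
  apply: (le_trans h2); apply: (@le_trans _ _ (`|C2| * (p + q))).
    by rewrite ler_wpM2r ?ler_norm// addr_ge0// (le_trans _ p1).
  by rewrite ler_wpM2l// lerD2r lerDr.
apply: (le_trans (ler_normD _ _)); rewrite [leRHS]mulrDl; apply: lerD; last first.
  apply: (le_trans h4); rewrite ler_wpM2l; [by []| |by lra].
  by rewrite !mulr_ge0 ?sqrtr_ge0// (le_trans _ D1).
apply: (le_trans (ler_normD _ _)); rewrite [leRHS]mulrDl; apply: lerD; last first.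
  by apply: (le_trans h3); rewrite ler_peMr//; lra.
apply: (le_trans h1); apply: (@le_trans _ _ (`|C1| * p)).
  by rewrite ler_wpM2r ?ler_norm// (le_trans _ p1).
by rewrite ler_wpM2l//; lra.
Qed.

(** The case f = 1 of [sum_indices_near]; rounding A x costs at most 1 <= x ^ theta. *)
Lemma counting_selected : exists C : R, forall w x, 1 <= x ->
  finite_set (indices_le (fun j => n j w) x) /\
  `|(counting_fun (fun j => n j w) x)%:R - A * x| <= C * x `^ theta.
Proof.
have [C CP] := sum_indices_near A0 K0 theta0 theta1.
exists (C + 1) => w x x1.
have [m sm /(_ (fun=> 1)) near1] := CP _ (in_windows_selected w) x x1.
split; first exact: indices_le_finite sm.
rewrite (counting_funE sm).
have Ax0 : 0 <= A * x by rewrite mulr_ge0 ?(ltW A0)// (le_trans _ x1).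
have /andP[Jl Ju] := truncn_itv Ax0.
have : `|(1 : R)| <= 1 by rewrite normr1.
move=> /(fun h => near1 (fun _ _ => h)).
rewrite [X in _ - X]sumr_const_nat subn1 /=.
set S := \sum_(j \in _) _; set J := Num.truncn (A * x) in Jl Ju *.
move=> h; have -> : S - A * x = (S - J%:R) - (A * x - J%:R) by ring.
apply: (le_trans (ler_normB _ _)); rewrite mulrDl; apply: lerD => //.
rewrite ger0_norm ?subr_ge0// mul1r; apply: (@le_trans _ _ 1).
  by move: Ju; rewrite -natr1; lra.
by rewrite -[leLHS](powRr0 x) ler_powR// ltW.
Qed.

Lemma ln_le_powR (y eps : R) : 0 < y -> 0 < eps -> ln y <= y `^ eps / eps.
Proof.
move=> y0 e0; rewrite ler_pdivlMr// mulrC -ln_powR ltW// ln_sublinear//.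
exact: powR_gt0.
Qed.

(** For x >= 1 the condition x <= |t| ^ B forces |t| >= 1, and the logarithms are absorbed by |t| ^
    eps. For x < 1, outside the range of the hypothesis on the sum, the left side is bounded and the
    right side is bounded below. *)
Lemma sum_osc_LH s phi (C : R) : in_windows A K theta s -> theta = 2^-1 ->
  (forall x t, 1 <= x -> `|\sum_(j \in indices_le s x) osc t phi (s j)
    - A * osc1 t phi x| <= C * error x t) ->
  forall eps B : R, 0 < eps -> 0 < B -> exists C' : R, forall t x,
    s 1%N <= x -> x <= `|t| `^ B ->
    `|\sum_(j \in indices_le s x) osc t phi (s j)
      - (A * osc1 t phi x - A * osc1 t phi (s 1%N))|
    <= C' * Num.sqrt (A * x) * `|t| `^ eps.
Proof.
move=> sw th sC eps B eps0 B0.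
have [C1 C1P] := sum_indices_near A0 K0 theta0 theta1.
have [m sm _] := C1P _ sw 1 (lexx _).
set a := s 1%N; have a0 : 0 < a by exact: in_windows_gt0 sw _.
(* A lower bound for sqrt (A x) |t| ^ eps, as a <= x <= |t| ^ B. *)
pose c1 : R := Num.sqrt (A * a) * (a `^ B^-1) `^ eps.
have c10 : 0 < c1 by rewrite mulr_gt0 ?powR_gt0// sqrtr_gt0 mulr_gt0.
(* From ln (x + 1) <= 1 + B ln |t|, ln (|t| + 1) <= 1 + ln |t| and ln |t| <= |t| ^ (2 eps) / (2
   eps); the square root turns 2 eps into eps. *)
pose E1 : R := 1 + B / (2 * eps); pose E2 : R := 1 + 1 / (2 * eps).
pose M1 : R := (m%:R + 2 * A) / c1.
pose M2 : R := (`|C| * (Num.sqrt E1 + Num.sqrt E2 + 2) + A * a) / Num.sqrt A.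
have sA : 0 < Num.sqrt A by rewrite sqrtr_gt0.
have Aa0 : 0 < A * a by rewrite mulr_gt0.
have M10 : 0 <= M1.
  by apply: divr_ge0 (ltW c10); rewrite addr_ge0// mulr_ge0// ltW.
have M20 : 0 <= M2.
  apply: divr_ge0 (ltW sA); apply: addr_ge0 (ltW Aa0).
  by rewrite mulr_ge0// !addr_ge0 ?sqrtr_ge0.
exists (M1 + M2) => t x ax xt.
have x0 : 0 < x by exact: lt_le_trans ax.
have sx0 : 0 <= Num.sqrt (A * x) by exact: sqrtr_ge0.
have te0 : 0 <= `|t| `^ eps by exact: powR_ge0.
have aosc : `|A * osc1 t phi a| <= A * a.
  by rewrite normrM gtr0_norm// ler_pM2l// norm_osc1_le// ltW.
have [x1|x1] := ltP x 1.
  have smx j : (0 < j)%N -> s j <= x -> (j < m)%N.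
    by move=> j0 sj; apply: sm => //; apply: le_trans sj (ltW x1).
  apply: (@le_trans _ _ (m%:R + 2 * A)).
    rewrite (sum_indices_le _ smx) opprB.
    apply: (le_trans (ler_normD _ _)); apply: lerD.
      apply: (le_trans (ler_norm_sum _ _ _)).
      apply: (@le_trans _ _ (\sum_(1 <= j < m) (1 : R))).
        rewrite big_mkcond/=; apply: ler_sum => j _.
        by case: ifP => // _; exact: norm_osc_le.
      by rewrite sumr_const_nat ler_nat leq_subr.
    apply: (le_trans (ler_normB _ _)).
    have -> : 2 * A = A + A by ring.
    apply: lerD.
      by apply: (le_trans aosc); rewrite ler_piMr ?(ltW A0)// (le_trans ax (ltW x1)).
    rewrite normrM (gtr0_norm A0) ler_piMr ?(ltW A0)//.
    by apply: (le_trans (norm_osc1_le _ _ (ltW x0))); exact: ltW.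
  apply: (@le_trans _ _ (M1 * Num.sqrt (A * x) * `|t| `^ eps)); last first.
    by rewrite -mulrA -[leRHS]mulrA ler_wpM2r ?mulr_ge0//; lra.
  rewrite -mulrA /M1 mulrAC ler_pdivlMr// ler_wpM2l ?addr_ge0 ?mulr_ge0 ?(ltW A0)//.
  rewrite /c1; apply: ler_pM; rewrite ?sqrtr_ge0 ?powR_ge0//.
    by rewrite ler_wsqrtr// ler_pM2l.
  apply: ge0_ler_powR; rewrite ?nnegrE ?powR_ge0 ?(ltW eps0)//.
  have -> : `|t| = (`|t| `^ B) `^ B^-1.
    by rewrite -powRrM mulfV ?gt_eqF// powRr1.
  apply: ge0_ler_powR; rewrite ?nnegrE ?powR_ge0 ?invr_ge0 ?(ltW B0) ?(ltW a0)//.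
  exact: le_trans ax xt.
have t1 : 1 <= `|t|.
  rewrite leNgt; apply/negP => t1.
  have : `|t| `^ B < 1.
    have <- : (1 : R) `^ B = 1 by rewrite powR1.
    by apply: gt0_ltr_powR; rewrite ?nnegrE.
  by rewrite ltNge (le_trans x1 xt).
have t0 : 0 < `|t| by exact: lt_le_trans t1.
have te1 : 1 <= `|t| `^ eps by rewrite -[leLHS](powRr0 `|t|) ler_powR// ltW.
have e2 : `|t| `^ (2 * eps) = (`|t| `^ eps) ^+ 2.
  by rewrite mulrC powRrM powR_mulrn.
have e20 : 0 < 2 * eps by rewrite mulr_gt0.
have lnt := ln_le_powR t0 e20; rewrite e2 in lnt.
have ln2 : ln 2 <= 1 :> R by have := @le_ln1Dx R 1; rewrite -natr1; apply; lra.
have lnt0 : 0 <= ln `|t| by exact: ln_ge0.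
have bound (y F : R) : 0 <= F -> y <= 1 + F * ln `|t| ->
    Num.sqrt y <= Num.sqrt (1 + F / (2 * eps)) * `|t| `^ eps.
  move=> F0 yF; set U := `|t| `^ eps in te1 lnt *.
  have F2 : 0 <= F / (2 * eps) by rewrite divr_ge0// ltW.
  have -> : Num.sqrt (1 + F / (2 * eps)) * U = Num.sqrt ((1 + F / (2 * eps)) * U ^+ 2).
    by rewrite sqrtrM ?addr_ge0// sqrtr_sqr ger0_norm.
  rewrite ler_wsqrtr// (le_trans yF)// mulrDl mul1r; apply: lerD.
    by rewrite expr_ge1.
  by rewrite -mulrA ler_wpM2l// (le_trans lnt)// mulrC.
have b1 : Num.sqrt (ln (x + 1)) <= Num.sqrt E1 * `|t| `^ eps.
  apply: bound; first exact: ltW.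
  apply: (@le_trans _ _ (ln (2 * `|t| `^ B))).
    rewrite ler_ln ?posrE ?mulr_gt0 ?powR_gt0//; last by lra.
    by move: x1 xt; lra.
  by rewrite lnM ?posrE ?powR_gt0// ln_powR lerD2r.
have b2 : Num.sqrt (ln (`|t| + 1)) <= Num.sqrt E2 * `|t| `^ eps.
  apply: bound => //; apply: (@le_trans _ _ (ln (2 * `|t|))).
    by rewrite ler_ln ?posrE ?mulr_gt0//; lra.
  by rewrite lnM ?posrE// mul1r lerD2r.
(* Here theta = 1 / 2 enters: both powers of x are sqrt x. *)
have eE : error x t = Num.sqrt x *
    (Num.sqrt (ln (x + 1)) + Num.sqrt (ln (`|t| + 1)) + 2).
  rewrite /error th; have -> : 1 - 2^-1 = 2^-1 :> R by lra.
  by rewrite powR12_sqrt ?(ltW x0)//; ring.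
have sx1 : 1 <= Num.sqrt x by rewrite -[leLHS]sqrtr1 ler_wsqrtr.
rewrite opprB addrCA; apply: (le_trans (ler_normD _ _)).
apply: (@le_trans _ _ (M2 * Num.sqrt (A * x) * `|t| `^ eps)); last first.
  by rewrite -mulrA -[leRHS]mulrA ler_wpM2r ?mulr_ge0//; lra.
have -> : M2 * Num.sqrt (A * x) * `|t| `^ eps = A * a * (Num.sqrt x * `|t| `^ eps) +
    `|C| * (Num.sqrt x * (Num.sqrt E1 * `|t| `^ eps + Num.sqrt E2 * `|t| `^ eps
      + 2 * `|t| `^ eps)).
  rewrite /M2 sqrtrM ?(ltW A0)//; field.
  by rewrite gt_eqF.
apply: lerD.
  apply: (le_trans aosc); rewrite ler_peMr ?(ltW Aa0)//.
  by rewrite -[leLHS]mulr1 ler_pM.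
apply: (le_trans (sC x t x1)); rewrite eE.
apply: (@le_trans _ _ (`|C| * (Num.sqrt x *
    (Num.sqrt (ln (x + 1)) + Num.sqrt (ln (`|t| + 1)) + 2)))).
  by rewrite ler_wpM2r ?ler_norm// mulr_ge0 ?sqrtr_ge0// !addr_ge0 ?sqrtr_ge0.
rewrite ler_wpM2l// ler_wpM2l ?sqrtr_ge0// !lerD//.
by rewrite ler_peMr.
Qed.

End Assembly.

Theorem theorem2p4 (R : realType) (d : measure_display) (T : measurableType d)
    (P : probability T R) (A K theta : R) (A0 : 0 < A) (K0 : 0 < K)
    (theta0 : 0 < theta) (theta1 : theta < 1) (n : nat -> {RV P >-> R})
    (n_unif : forall (j : nat) (j0 : (0 < j)%N),
      uniformly_selected (n j) (sel_lt theta A0 K0 j0))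
    (n_indep : mutually_independent [set j : nat | (0 < j)%N] n) :
  [/\ exists C : R, forall (w : T) (x : R), 1 <= x ->
        finite_set (indices_le (fun j => n j w) x) /\
        `|(counting_fun (fun j => n j w) x)%:R - A * x| <= C * x `^ theta,
      {ae P, forall w : T, exists C : R, forall x t : R, 1 <= x ->
        Normc.normc (power_sum (fun j => n j w) x t
          - A%:C * cpowR x (1 -i* t) / (1 -i* t))
        <= C * (Num.sqrt x * (Num.sqrt (ln (x + 1)) + Num.sqrt (ln (`|t| + 1)))
                + x `^ theta + x `^ (1 - theta))} &
      theta = 2^-1 ->
        {ae P, forall w : T, LH (fun j => n j w) (fun x => A * x)}].
Proof.
(* For x < 1 the bound at 1 serves. *)
have bounded w x : exists m : nat, forall j, (0 < j)%N -> n j w <= x -> (j < m)%N.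
  have [C CP] := sum_indices_near A0 K0 theta0 theta1.
  have x1 : 1 <= Num.max 1 x by rewrite le_max lexx.
  have [m mP _] := CP _ (in_windows_selected n_unif w) _ x1.
  by exists m => j j0 nx; apply: mP => //; rewrite le_max nx orbT.
have aeRe := ae_sum_osc theta0 theta1 n_unif n_indep 0.
have aeIm := ae_sum_osc theta0 theta1 n_unif n_indep (pi / 2).
split.
- exact: (counting_selected theta0 theta1 n_unif).
- apply: filterS2 aeRe aeIm => w [C1 C1P] [C2 C2P].
  exists (C1 + C2) => x t x1; have [m mP] := bounded w x.
  apply: (le_trans (normc_le _)); rewrite mulrDl.
  rewrite cpowR_antideriv; last exact: lt_le_trans x1.
  apply: lerD.
  + have := C1P x t x1; rewrite -(Re_power_sum t mP).
    by case: (power_sum _ _ _).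
  + have := C2P x t x1; rewrite -(Im_power_sum t mP).
    by case: (power_sum _ _ _).
- move=> th; apply: filterS2 aeRe aeIm => w [C1 C1P] [C2 C2P] eps B eps0 B0.
  have sw := in_windows_selected n_unif w.
  have [D1 D1P] := sum_osc_LH A0 K0 theta0 theta1 sw th C1P eps0 B0.
  have [D2 D2P] := sum_osc_LH A0 K0 theta0 theta1 sw th C2P eps0 B0.
  exists (D1 + D2) => t x ax xt; have [m mP] := bounded w x.
  apply: (le_trans (normc_le _)); rewrite -mulrA mulrDl !mulrA.
  rewrite Cintegral_cpowR//; last exact: in_windows_gt0 sw _.
  apply: lerD.
  + have := D1P t x ax xt; rewrite -(Re_power_sum t mP).
    by case: (power_sum _ _ _).
  + have := D2P t x ax xt; rewrite -(Im_power_sum t mP).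
    by case: (power_sum _ _ _).
Qed.
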